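(* For a tree $T$ on $n$ vertices and a positive integer $k$, the $k$-color connection number $cc_k(T)$ can be computed in time linear in $n$.
   Context: For an edge-coloring $f$ of a connected graph $G$ and vertices $u,v$, the color-distance $cd_f(u,v)$ is the minimum number of distinct colors appearing on a $u$–$v$ path ($0$ if $u=v$), and the color-diameter is $cD_f(G)=\max_{u,v}cd_f(u,v)$. An edge-coloring $f$ is a $k$-color connection coloring if $cD_f(G)\le k$, and $cc_k(G)$ is the maximum number of colors used by a $k$-color connection coloring of $G$. *)

(* Defs.v *)
From mathcomp Require Import all_boot.

Set Implicit Arguments.
Unset Strict Implicit.
Unset Printing Implicit Defensive.

(** * Graphs and trees *)

Section Graphs.
Variables (T : finType) (e : rel T).

Definition simple_graph : Prop := symmetric e /\ irreflexive e.

Definition connected_graph : Prop := forall u v, connect e u v.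

(* For symmetric e, [ucycle e [:: u; v]] holds on every edge uv, so the cycles
   of the graph are the ucycles of length at least 3. *)
Definition acyclic_graph : Prop := forall c, ucycle e c -> size c < 3.

Definition is_tree : Prop :=
  [/\ 0 < #|T|, simple_graph, connected_graph & acyclic_graph].

Definition edge_set : {set {set T}} :=
  [set [set p.1; p.2] | p in [set p : T * T | e p.1 p.2]].

(* es lists every edge exactly once, in any order and with its two endpoints
   in any order. *)
Definition edge_list (es : seq (T * T)) : Prop :=
  perm_eq [seq [set p.1; p.2] | p <- es] (enum edge_set).

(** * Color connection *)

(* Colors are natural numbers; only the values of f on [edge_set] matter, and
   f need not be proper. *)
Implicit Type f : {set T} -> nat.

Definition colors_used f : nat :=
  size (undup [seq f E | E <- enum edge_set]).

(* The vertices of the path are u :: p. *)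
Definition path_colors f (u : T) (p : seq T) : nat :=
  size (undup (pairmap (fun x y => f [set x; y]) u p)).

Definition is_path (u v : T) (p : seq T) : bool :=
  [&& path e u p, last u p == v & uniq (u :: p)].

(* A path has fewer than #|T| edges, so the value #|T| of the empty minimum is
   harmless; see [color_distP]. *)
Definition color_dist f (u v : T) : nat :=
  \big[minn/#|T|]_(p : {bseq #|T| of T} | is_path u v p) path_colors f u p.

Definition color_diam f : nat := \max_(u : T) \max_(v : T) color_dist f u v.

Definition color_connection k f : Prop := color_diam f <= k.

Definition is_cc (k m : nat) : Prop :=
  (exists2 f, color_connection k f & colors_used f = m) /\
  (forall f, color_connection k f -> colors_used f <= m).

Lemma is_path_size u v p : is_path u v p -> size p < #|T|.
Proof. by case/and3P=> _ _ /card_uniqP uq; rewrite -[(size p).+1]uq max_card. Qed.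

Lemma color_distP f u v : connect e u v ->
  (exists2 p, is_path u v p & path_colors f u p = color_dist f u v) /\
  (forall p, is_path u v p -> color_dist f u v <= path_colors f u p).
Proof.
move=> /connectP[q0 eq0 ->{v}].
have [q eq uq _] := shortenP eq0; set v := last u q.
have le_cd p : is_path u v p -> color_dist f u v <= path_colors f u p.
  move=> pP; have szp := ltnW (is_path_size pP).
  rewrite /color_dist; have: Bseq szp \in index_enum {bseq #|T| of T}.
    exact: mem_index_enum.
  elim: (index_enum _) => //= b s IHs; rewrite inE big_cons.
  case/predU1P=> [<-|/IHs le_s]; first by rewrite pP geq_minl.
  by case: ifP => // _; apply: leq_trans le_s; apply: geq_minr.
split=> //; have qP : is_path u v q by rewrite /is_path eq eqxx.
have: color_dist f u v = #|T| \/
      exists2 p, is_path u v p & path_colors f u p = color_dist f u v.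
  rewrite /color_dist; elim/big_ind: _ => [|x y Hx Hy|p pP].
  - by left.
  - by case: (leqP x y) => _.
  - by right; exists (p : seq T).
case=> // Ecd; have := le_cd _ qP; rewrite Ecd leqNgt => /negP[].
apply: leq_ltn_trans (is_path_size qP).
by apply: leq_trans (size_undup _) _; rewrite size_pairmap.
Qed.

End Graphs.

(** * Random access machines *)

(* A RAM with immediate, direct and indirect addressing, addition, truncated
   subtraction and conditional jumps, each instruction having unit cost.
   The run below also bounds the contents of every cell, so that with a bound
   polynomial in the input parameters this is the RAM with words of
   logarithmic length. *)

Inductive loc := Dir of nat | Ind of nat.

Inductive operand := Imm of nat | Cell of loc.

Inductive instr :=
| IMov of loc & operand
| IAdd of loc & operand & operand
| ISub of loc & operand & operand
| IJmp of nat
| IJle of operand & operand & nat.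

Definition program := seq instr.

Definition memory := nat -> nat.

Record state := State { st_pc : nat; st_mem : memory }.

Definition upd (m : memory) (a x : nat) : memory :=
  fun b => if b == a then x else m b.

Definition loc_addr (m : memory) (l : loc) : nat :=
  match l with Dir a => a | Ind a => m a end.

Definition operand_val (m : memory) (o : operand) : nat :=
  match o with Imm x => x | Cell l => m (loc_addr m l) end.

Definition exec (i : instr) (s : state) : state :=
  let: State q m := s in
  match i with
  | IMov l x => State q.+1 (upd m (loc_addr m l) (operand_val m x))
  | IAdd l x y => State q.+1 (upd m (loc_addr m l) (operand_val m x + operand_val m y))
  | ISub l x y => State q.+1 (upd m (loc_addr m l) (operand_val m x - operand_val m y))
  | IJmp j => State j m
  | IJle x y j => State (if operand_val m x <= operand_val m y then j else q.+1) m
  end.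

Definition halted (P : program) (s : state) : bool := size P <= st_pc s.

Definition step (P : program) (s : state) : state :=
  if onth P (st_pc s) is Some i then exec i s else s.

Definition start (input : seq nat) : state := State 0 (nth 0 input).

(* Started on the input, P halts after at most [time] steps with [output] in
   cell 0, and no cell ever holds a value exceeding [word]. *)
Definition ram_computes (P : program) (input : seq nat)
    (time word output : nat) : Prop :=
  exists2 t, t <= time &
    [/\ halted P (iter t (step P) (start input)),
        st_mem (iter t (step P) (start input)) 0 = output &
        forall i a, i <= t -> st_mem (iter i (step P) (start input)) a <= word].

Definition tree_input (n k : nat) (es : seq ('I_n * 'I_n)) : seq nat :=
  n :: k :: flatten [seq [:: val p.1; val p.2] | p <- es].

(* Main.v *)
Require Import Defs.
From mathcomp Require Import all_boot zify.

(** Let L be the number of leaves of T. If k >= 3 and T has at least 3 vertices then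
    cc_k(T) = L + cc_{k-2}(T - leaves); moreover cc_2(T) is the maximum degree and
    cc_1(T) is 1 unless T is a single vertex.

    For the lower bound, color the leaf edges with fresh colors; for k = 2, color each
    edge by its component of T - v, where v has maximum degree. For the upper bound,
    pick one representative edge per color. By exchanging representatives one finds a
    vertex v such that a path starting at v has fewer than k/2 representatives after
    its first edge. Deleting, for every leaf, the last representative on the path from
    v to it then gives such a configuration for T - leaves and k - 2.

    The program stores the degree of each vertex and the sum of its neighbours, which
    for a leaf is its only neighbour, so that leaves can be removed one by one from a
    queue without adjacency lists. *)

Set Implicit Arguments.
Unset Strict Implicit.
Unset Printing Implicit Defensive.

Lemma size_undup_subset (X : eqType) (s t : seq X) :
  {subset s <= t} -> size (undup s) <= size t.
Proof.
by move=> st; apply: uniq_leq_size (undup_uniq _) _ => x; rewrite mem_undup => /st.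
Qed.

Lemma size_undup_ends (X : eqType) (x y : X) s :
  size (undup (x :: rcons s y)) <= (size (undup s)).+2.
Proof.
apply: (size_undup_subset (t := [:: x, y & undup s])) => z.
by rewrite !inE mem_rcons inE mem_undup.
Qed.

Lemma sub_in_count (X : eqType) (a b : pred X) (s : seq X) :
  {in s, subpred a b} -> count a s <= count b s.
Proof.
elim: s => //= x s IHs ab; apply: leq_add.
  by have := ab x (mem_head _ _); case: (a x) => // ->.
by apply: IHs => y ys; apply: ab; rewrite inE ys orbT.
Qed.

Lemma uniq_map_inj_in (X Y : eqType) (f : X -> Y) (s : seq X) :
  uniq (map f s) -> {in s &, injective f}.
Proof.
elim: s => //= x s IHs /andP[fx us] y z.
rewrite !inE => /predU1P[->|ys] /predU1P[->|zs] // E; last exact: IHs.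
  by rewrite E map_f in fx.
by rewrite -E map_f in fx.
Qed.

Lemma last_rev_belast (X : Type) (x : X) s : last (last x s) (rev (belast x s)) = x.
Proof. by case: s => //= y s; rewrite rev_cons last_rcons. Qed.

Lemma eq_set2 (X : finType) (a b c d : X) : [set a; b] = [set c; d] ->
  (a = c /\ b = d) \/ (a = d /\ b = c).
Proof.
move=> E; have mem x : (x \in [set a; b]) = (x \in [set c; d]) by rewrite E.
have := mem a; have := mem b; have := mem c; have := mem d.
rewrite !inE !eqxx !orbT.
move=> /orP[]/eqP ? /orP[]/eqP ? /esym/orP[]/eqP ? /esym/orP[]/eqP ?; subst; auto.
Qed.

(** * Paths in forests *)

Section SimplePaths.
Variable T : finType.
Implicit Types (g h : rel T) (u v x y z : T) (p q s : seq T) (S : {set {set T}}).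

Definition forest g : Prop := simple_graph g /\ acyclic_graph g.

Definition spath g u p : bool := path g u p && uniq (u :: p).

Definition del_vertex g u : rel T := [rel x y | [&& g x y, x != u & y != u]].

Definition del_edge g a b : rel T := [rel x y | g x y && ([set x; y] != [set a; b])].

Definition side g a b : {set T} := [set z | connect (del_edge g a b) b z].

Definition path_edges u p : seq {set T} := pairmap (fun x y => [set x; y]) u p.

Definition marks S u p : nat := count (mem S) (path_edges u p).

Lemma edge_setP g E : reflect (exists x y, g x y /\ E = [set x; y]) (E \in edge_set g).
Proof.
apply: (iffP imsetP) => [[[x y]]|[x [y [gxy ->]]]].
  by rewrite inE /= => gxy ->; exists x, y.
by exists (x, y); rewrite ?inE.
Qed.

Lemma mem_edge_set g x y : symmetric g -> ([set x; y] \in edge_set g) = g x y.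
Proof.
move=> gS; apply/edge_setP/idP => [[a [b [gab /eq_set2[][-> ->] //]]]|gxy].
  by rewrite gS.
by exists x, y.
Qed.

Lemma path_edges_cat u p q :
  path_edges u (p ++ q) = path_edges u p ++ path_edges (last u p) q.
Proof. exact: pairmap_cat. Qed.

Lemma path_edges_cons u x p : path_edges u (x :: p) = [set u; x] :: path_edges x p.
Proof. by []. Qed.

Lemma path_edges_rcons u p z :
  path_edges u (rcons p z) = rcons (path_edges u p) [set last u p; z].
Proof. by rewrite -!cats1 path_edges_cat. Qed.

Lemma path_edges_rev u p :
  path_edges (last u p) (rev (belast u p)) = rev (path_edges u p).
Proof.
elim: p u => //= x p IHp u.
by rewrite !rev_cons path_edges_rcons IHp last_rev_belast setUC.
Qed.

Lemma mem_path_edges u p E : E \in path_edges u p -> {subset E <= u :: p}.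
Proof.
elim: p u => //= x p IHp u; rewrite inE => /predU1P[-> z|/IHp sE z /sE].
  by rewrite !inE => /orP[]/eqP->; rewrite eqxx ?orbT.
by rewrite !inE => ->; rewrite orbT.
Qed.

Lemma notin_path_edges u p x y : x \notin u :: p -> [set x; y] \notin path_edges u p.
Proof. by apply: contra => /mem_path_edges; apply; rewrite set21. Qed.

Lemma uniq_path_edges u p : uniq (u :: p) -> uniq (path_edges u p).
Proof.
elim: p u => //= x p IHp u /andP[ux Ux].
by rewrite IHp // andbT; apply: notin_path_edges.
Qed.

Lemma path_edges_sub g u p : path g u p -> {subset path_edges u p <= edge_set g}.
Proof.
elim: p u => //= x p IHp u /andP[gux gp] E; rewrite inE => /predU1P[->|/IHp->] //.
by apply/edge_setP; exists u, x.
Qed.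

Lemma marks_cat S u p q : marks S u (p ++ q) = marks S u p + marks S (last u p) q.
Proof. by rewrite /marks path_edges_cat count_cat. Qed.

Lemma marks_cons S u x p : marks S u (x :: p) = ([set u; x] \in S) + marks S x p.
Proof. by []. Qed.

Lemma marks_rev S u p : marks S (last u p) (rev (belast u p)) = marks S u p.
Proof. by rewrite /marks path_edges_rev count_rev. Qed.

Lemma marks_subset S S' u p : S \subset S' -> marks S u p <= marks S' u p.
Proof. by move=> /subsetP SS'; apply: sub_count => E; apply: SS'. Qed.

Lemma path_colorsE f u p : path_colors f u p = size (undup (map f (path_edges u p))).
Proof.
rewrite /path_colors; congr (size (undup _)).
by elim: p u => //= x p IHp u; rewrite IHp.
Qed.

Lemma marks_le_colors S (f : {set T} -> nat) u p :
  uniq (u :: p) -> {in S &, injective f} -> marks S u p <= path_colors f u p.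
Proof.
move=> /uniq_path_edges Up injf; rewrite path_colorsE /marks -size_filter -(size_map f).
apply: uniq_leq_size => [|c /mapP[E]].
  rewrite map_inj_in_uniq ?filter_uniq // => E E'.
  by rewrite !mem_filter => /andP[SE _] /andP[SE' _]; apply: injf.
by rewrite mem_filter mem_undup => /andP[_ pE] ->; apply: map_f.
Qed.

Lemma spath_cat g u p q : spath g u (p ++ q) =
  [&& spath g u p, spath g (last u p) q & ~~ has [in u :: p] q].
Proof.
rewrite /spath cat_path -cat_cons cat_uniq [uniq (last u p :: q)]/=.
case: (path g u p) (path g _ q) (uniq (u :: p)) (uniq q) => [] [] [] [] //=;
  rewrite ?andbF ?andbT //=.
apply/idP/andP => [nq|[]//]; split=> //.
by apply: contra nq => lq; apply/hasP; exists (last u p); rewrite ?mem_last.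
Qed.

Lemma spath_cons g u x p :
  spath g u (x :: p) = [&& g u x, spath g x p & u \notin x :: p].
Proof. by rewrite /spath cons_uniq /= [(u \notin _) && _]andbC !andbA. Qed.

Lemma spath_rcons g u p z :
  spath g u (rcons p z) = [&& spath g u p, g (last u p) z & z \notin u :: p].
Proof.
rewrite /spath rcons_path -rcons_cons rcons_uniq.
by case: (path g u p) (g _ z) (uniq _) => [] [] []; rewrite ?andbF ?andbT.
Qed.

Lemma spath_catr g u p q : spath g u (p ++ q) -> spath g (last u p) q.
Proof. by rewrite spath_cat => /and3P[]. Qed.

Lemma sub_spath g h u p : subrel g h -> spath g u p -> spath h u p.
Proof. by move=> gh /andP[gp up]; rewrite /spath (sub_path gh gp). Qed.

Lemma spath_rev g u p : symmetric g ->
  spath g (last u p) (rev (belast u p)) = spath g u p.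
Proof.
move=> gS; rewrite /spath rev_path (eq_path (e' := g)) => [|x y]; last exact: gS.
by congr (_ && _); rewrite -rev_rcons -lastI rev_uniq.
Qed.

Lemma connect_spath g u v : connect g u v -> exists2 p, spath g u p & v = last u p.
Proof.
case/connectP=> p gp ->; have [q gq uq _] := shortenP gp.
by exists q; rewrite // /spath gq.
Qed.

Lemma spath_size g u p : spath g u p -> size p < #|T|.
Proof.
case/andP=> gp up; apply: (is_path_size (e := g) (u := u) (v := last u p)).
by rewrite /is_path gp eqxx.
Qed.

Lemma del_vertex_sym g u : symmetric g -> symmetric (del_vertex g u).
Proof. by move=> gS x y; rewrite /del_vertex /= gS; congr (_ && _); rewrite andbC. Qed.

Lemma del_edge_sym g a b : symmetric g -> symmetric (del_edge g a b).
Proof. by move=> gS x y; rewrite /del_edge /= gS setUC. Qed.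

Lemma connect_del_vertex g u x p z :
  path g x p -> u \notin x :: p -> z \in x :: p -> connect (del_vertex g u) x z.
Proof.
elim: p x => [|y p IHp] x /=; first by rewrite !inE => _ _ /eqP->.
case/andP=> gxy gp; rewrite inE negb_or => /andP[ux uyp].
rewrite inE => /predU1P[->|zp]; first exact: connect0.
apply: connect_trans (IHp _ gp uyp zp); apply: connect1.
rewrite /del_vertex /= gxy eq_sym ux /=.
by apply: contraNneq uyp => ->; rewrite mem_head.
Qed.

Lemma connect_del_edge g a b x p z :
  path g x p -> a \notin x :: p -> z \in x :: p -> connect (del_edge g a b) x z.
Proof.
move=> gp ap zp; apply: connect_sub (connect_del_vertex gp ap zp) => c d.
case/and3P=> gcd nca nda; apply: connect1; rewrite /del_edge /= gcd.
by apply/eqP => /eq_set2[][E1 E2]; [rewrite E1 eqxx in nca | rewrite E2 eqxx in nda].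
Qed.

Lemma notin_path_del_vertex g u x p :
  x != u -> path (del_vertex g u) x p -> u \notin x :: p.
Proof.
elim: p x => [|y p IHp] x nxu; first by rewrite inE eq_sym.
by case/andP=> /and3P[_ _ nyu] /(IHp _ nyu); rewrite [in X in _ -> X]inE eq_sym negb_or nxu.
Qed.

Lemma spath_side g a b p : spath g a (b :: p) -> {subset b :: p <= side g a b}.
Proof.
rewrite spath_cons => /and3P[_ /andP[gp _] nab] z zp.
by rewrite inE; apply: connect_del_edge gp nab zp.
Qed.

Section Forest.
Variable g : rel T.
Hypothesis forest_g : forest g.

Lemma forest_sym : symmetric g.
Proof. by case: forest_g => -[]. Qed.

Lemma forest_irr : irreflexive g.
Proof. by case: forest_g => -[]. Qed.

Lemma forest_neq x y : g x y -> x != y.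
Proof. by apply: contraTneq => ->; rewrite forest_irr. Qed.

Lemma forest_closed_path u p : spath g u p -> g (last u p) u -> size p <= 1.
Proof.
case/andP=> gp up gl; case: forest_g => _ /(_ (u :: p)).
by rewrite /ucycle /= rcons_path gp gl; apply.
Qed.

Lemma forest_branch u x y :
  g u x -> g u y -> connect (del_vertex g u) x y -> x = y.
Proof.
move=> gux guy /connect_spath[p /andP[hp up] yE].
have nu : u \notin x :: p.
  by apply: notin_path_del_vertex hp; rewrite eq_sym forest_neq.
have gp : path g x p by apply: sub_path hp => a b /and3P[].
have gxp : spath g u (x :: p) by rewrite spath_cons gux nu /spath gp up.
have := forest_closed_path gxp; rewrite /= -yE forest_sym => /(_ guy).
by case: p yE {hp up nu gp gxp}.
Qed.

Lemma spath_unique u p q :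
  spath g u p -> spath g u q -> last u p = last u q -> p = q.
Proof.
elim: p u q => [|x p IHp] u [|y q] //=.
- by rewrite spath_cons => _ /and3P[_ _ +] E; rewrite E mem_last.
- by rewrite spath_cons => /and3P[_ _ +] _ E; rewrite -E mem_last.
rewrite !spath_cons => /and3P[gux gp ux] /and3P[guy gq uy] E.
have [[gxp _] [gyq _]] := (andP gp, andP gq).
suff xy : x = y by rewrite -xy in E gq *; rewrite (IHp x q).
apply: (forest_branch gux guy).
apply: connect_trans (connect_del_vertex gxp ux (mem_last _ _)) _; rewrite E.
rewrite (sym_connect_sym (del_vertex_sym u forest_sym)).
exact: connect_del_vertex gyq uy (mem_last _ _).
Qed.

Lemma spath_disjoint u x p y q : x != y ->
  spath g u (x :: p) -> spath g u (y :: q) -> ~~ has [in x :: p] (y :: q).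
Proof.
rewrite !spath_cons => nxy /and3P[gux /andP[gp _] ux] /and3P[guy /andP[gq _] uy].
apply: contraNN nxy => /hasP[z zq zp]; apply/eqP/(forest_branch gux guy).
apply: connect_trans (connect_del_vertex gp ux zp) _.
rewrite (sym_connect_sym (del_vertex_sym u forest_sym)).
exact: connect_del_vertex gq uy zq.
Qed.

Lemma spath_join u x p q :
  spath g u (x :: p) -> spath g u q -> x != head u q ->
  exists v s, spath g v s /\
    forall S, marks S v s = marks S u (x :: p) + marks S u q.
Proof.
move=> gp gq nx; exists (last u q), (rev (belast u q) ++ x :: p); split; last first.
  by move=> S; rewrite marks_cat addnC last_rev_belast marks_rev.
rewrite spath_cat spath_rev ?last_rev_belast ?gq ?gp; last exact: forest_sym.
rewrite -rev_rcons -lastI; apply/hasPn => z zp; rewrite mem_rev inE negb_or.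
apply/andP; split.
  by apply: contraTneq zp => ->; move: gp; rewrite spath_cons => /and3P[].
case: q gq nx => // y q gq nxy; apply: contra (spath_disjoint nxy gp gq) => zq.
by apply/hasP; exists z.
Qed.

Lemma forest_bridge a b : g a b -> ~~ connect (del_edge g a b) a b.
Proof.
move=> gab; apply/negP => /connect_spath[p hp bE].
have gp : spath g a p by apply: sub_spath hp => x y /andP[].
have := forest_closed_path gp; rewrite -bE forest_sym gab => /(_ isT).
case: p hp bE gp => [_ bE|x [|//] /andP[hx _] /= bx] _ _.
  by move: gab; rewrite bE forest_irr.
by move: hx; rewrite /= /del_edge /= -bx eqxx !andbF.
Qed.

Lemma side_disjoint a b z : g a b -> z \in side g a b -> z \notin side g b a.
Proof.
move=> gab; rewrite !inE => bz; apply/negP => az; have /negP[] := forest_bridge gab.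
rewrite (eq_connect (e' := del_edge g a b)) in az; last first.
  by move=> x y; rewrite /del_edge /= [[set b; a]]setUC.
apply: connect_trans az _.
by rewrite (sym_connect_sym (del_edge_sym a b forest_sym)).
Qed.

Lemma mem_side a b : b \in side g a b.
Proof. by rewrite inE connect0. Qed.

Lemma side_exit a b y z : g a b ->
  y \in side g b a -> z \notin side g b a -> g y z -> y = a /\ z = b.
Proof.
move=> gab ya nza gyz.
have nb : b \notin side g b a by apply: side_disjoint (mem_side _ _).
case: (eqVneq [set y; z] [set b; a]) => [/eq_set2[][yE zE] //|ne].
  by rewrite yE (negbTE nb) in ya.
move: ya nza; rewrite !inE => ya /negP[]; apply: connect_trans ya (connect1 _).
by rewrite /del_edge /= gyz.
Qed.

Lemma spath_back_edge v w z p :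
  spath g v (rcons p z) -> w \in v :: rcons p z -> g z w -> w = last v p.
Proof.
move=> gp wp gzw; have {}wp : w \in v :: p.
  move: wp; rewrite -rcons_cons mem_rcons inE eq_sym.
  by rewrite (negbTE (forest_neq gzw)).
case/splitPl: wp gp => p1 p2 wE; rewrite rcons_cat => /spath_catr.
rewrite wE => gp2; have := forest_closed_path gp2.
rewrite last_rcons size_rcons => /(_ gzw); case: p2 {gp2} => // _.
by rewrite cats0.
Qed.

End Forest.

Section TreePath.
Variable g : rel T.
Hypothesis forest_g : forest g.

Definition tree_path v z : seq T :=
  odflt [::] (omap val [pick p : {bseq #|T| of T} | spath g v p && (last v p == z)]).

Lemma tree_pathE v p : spath g v p -> tree_path v (last v p) = p.
Proof.
move=> gp; rewrite /tree_path; case: pickP => [q /andP[gq /eqP lq]|no] /=.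
  exact: (spath_unique forest_g gq gp).
by have := no (Bseq (ltnW (spath_size gp))); rewrite /= gp eqxx.
Qed.

Definition parent_edge v z : {set T} := last set0 (path_edges v (tree_path v z)).

Lemma parent_edgeE v p z :
  spath g v (rcons p z) -> parent_edge v z = [set last v p; z].
Proof.
move=> gp; rewrite /parent_edge -{1}(last_rcons v p z) tree_pathE //.
by rewrite path_edges_rcons last_rcons.
Qed.

Lemma parent_edge_inj v p q y z : spath g v (rcons p y) -> spath g v (rcons q z) ->
  parent_edge v y = parent_edge v z -> y = z.
Proof.
move=> gp gq; rewrite (parent_edgeE gp) (parent_edgeE gq).
case/eq_set2=> [[_ //]|[zE yE]].
have init t w : spath g v (rcons t w) -> spath g v t by rewrite spath_rcons => /and3P[].
have : q = rcons p y by apply: spath_unique (init _ _ gq) gp _; rewrite // last_rcons.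
have : p = rcons q z by apply: spath_unique (init _ _ gp) gq _; rewrite // last_rcons.
by move=> /(congr1 size) + /(congr1 size); rewrite !size_rcons; lia.
Qed.

End TreePath.
End SimplePaths.

(** * Centers of colorings *)

Section Center.
Variable T : finType.
Implicit Types (g h : rel T) (u v x y z : T) (p q : seq T) (S : {set {set T}}).

Definition shallow g S r a b : Prop :=
  forall p, spath g a (b :: p) -> marks S b p <= r.

Definition center g k S v : Prop :=
  (forall x p, spath g v (x :: p) -> (marks S x p).*2 < k) /\
  (forall x p y q, x != y -> spath g v (x :: p) -> spath g v (y :: q) ->
     marks S v (x :: p) + marks S v (y :: q) <= k).

Definition color_bounded g k (f : {set T} -> nat) : Prop :=
  forall u p, spath g u p -> path_colors f u p <= k.

Lemma shallow_or_deep g S r a b :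
  shallow g S r a b \/ exists2 p, spath g a (b :: p) & r < marks S b p.
Proof.
case: (pickP [pred p : {bseq #|T| of T} | spath g a (b :: p) && (r < marks S b p)]).
  by move=> p /andP[gp deep]; right; exists (p : seq T).
move=> none; left=> p gp; rewrite leqNgt.
have := none (Bseq (ltnW (ltnW (spath_size gp)))); rewrite /= gp /=.
by move=> ->.
Qed.

Lemma center_sub g h k S S' v :
  subrel h g -> S' \subset S -> center g k S v -> center h k S' v.
Proof.
move=> hg S'S [half sum]; have le u p := marks_subset u p S'S.
split=> [x p gp|x p y q nxy gp gq].
  by apply: leq_ltn_trans (half x p (sub_spath hg gp)); rewrite leq_double.
apply: leq_trans (sum x p y q nxy (sub_spath hg gp) (sub_spath hg gq)).
exact: leq_add.
Qed.

Section Representatives.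
Variables (g : rel T) (f : {set T} -> nat).

Definition selects S : Prop :=
  [/\ S \subset edge_set g, {in S &, injective f} &
      forall E, E \in edge_set g -> exists2 E', E' \in S & f E' = f E].

Lemma exists_selects : exists S, selects S.
Proof.
pose rep E := [pick E' in edge_set g | f E' == f E].
have eq_rep E E' : f E = f E' -> rep E = rep E'.
  by move=> fE; apply: eq_pick => F; rewrite /= fE.
exists [set E in edge_set g | rep E == Some E]; split.
- by apply/subsetP => E /setIdP[].
- move=> E E'; rewrite !inE => /andP[_ /eqP repE] /andP[_ /eqP repE'] /eq_rep.
  by rewrite repE repE' => -[].
move=> E Eg; have : rep E = rep E by []; rewrite {1}/rep.
case: pickP => [E' /andP[E'g /eqP fE'] /esym repE|/(_ E)]; last by rewrite Eg eqxx.
by exists E'; rewrite // inE E'g (eq_rep _ _ fE') repE /=.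
Qed.

Lemma card_selects S : selects S -> #|S| = colors_used g f.
Proof.
case=> SE inj cover; rewrite cardE -(size_map f); apply/perm_size/uniq_perm.
- by rewrite map_inj_in_uniq ?enum_uniq // => E E'; rewrite !mem_enum; apply: inj.
- exact: undup_uniq.
move=> c; rewrite mem_undup; apply/mapP/mapP => -[E]; rewrite mem_enum => Ein ->.
  by exists E; rewrite ?mem_enum ?(subsetP SE).
by have [E' E'S <-] := cover E Ein; exists E'; rewrite ?mem_enum.
Qed.

Lemma selects_swap S s E : selects S -> s \in S -> E \in edge_set g -> f s = f E ->
  selects (E |: S :\ s).
Proof.
move=> [SE inj cover] sS Eg fsE; split.
- by apply/subsetP => F; rewrite !inE => /predU1P[->|/andP[_ /(subsetP SE)]].
- move=> F F'; rewrite !inE => /predU1P[->|/andP[nF FS]] /predU1P[->|/andP[nF' FS']] //.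
  + by rewrite -fsE => /(inj _ _ sS FS') E'; rewrite E' eqxx in nF'.
  + by rewrite -fsE => /(inj _ _ FS sS) E'; rewrite E' eqxx in nF.
  + exact: inj.
- move=> F /cover[t tS ft]; case: (eqVneq t s) => [ts|nts].
    by exists E; rewrite ?setU11 // -fsE -ts.
  by exists t; rewrite // !inE nts tS orbT.
Qed.

End Representatives.

Section ShallowRoot.
Variables (g : rel T) (f : {set T} -> nat) (r : nat).
Hypotheses (forest_g : forest g) (f_bounded : color_bounded g r.*2.+2 f).

Let gS : symmetric g := forest_sym forest_g.

Definition confined S (Y : {set T}) : Prop :=
  forall y z, y \in Y -> z \notin Y -> g y z ->
    [disjoint side g y z & Y] /\ shallow g S r y z.

Lemma swap_shallow S s a b :
  selects g f S -> s \in S -> g a b -> f s = f [set a; b] ->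
  shallow g (S :\ s) r a b \/ shallow g (S :\ s) r b a.
Proof.
move=> selS sS gab fs; have gba : g b a by rewrite gS.
have Eg : [set a; b] \in edge_set g by rewrite mem_edge_set.
have [_ inj _] := selects_swap selS sS Eg fs; set S' := _ |: _ in inj.
have [?|[p gp deep_p]] := shallow_or_deep g (S :\ s) r a b; first by left.
right=> q gbq; rewrite leqNgt; apply/negP => deep_q.
have gq : spath g a q by move: gbq; rewrite spath_cons => /and3P[].
have nhd : b != head a q.
  move: gbq; rewrite spath_cons => /and3P[_ _]; apply: contraNneq => ->.
  by case: q {gq deep_q} => [|y q]; rewrite ?mem_head // !inE eqxx orbT.
have [v [t [gt tE]]] := spath_join forest_g gp gq nhd.
have /andP[_ ut] := gt; have := leq_trans (marks_le_colors ut inj) (f_bounded gt).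
have deep_swap u p' : r < marks (S :\ s) u p' -> r < marks S' u p'.
  by move=> deep; apply: leq_trans deep (marks_subset _ _ (subsetUr _ _)).
rewrite tE marks_cons setU11; have := deep_swap _ _ deep_p; have := deep_swap _ _ deep_q.
by rewrite /=; lia.
Qed.

Lemma confined_swap S s a b (Y : {set T}) :
  confined S Y -> a \in Y -> b \in Y -> g a b -> shallow g (S :\ s) r a b ->
  confined ([set a; b] |: S :\ s) (Y :&: side g b a).
Proof.
move=> confS aY bY gab sh y z; rewrite !in_setI negb_and => /andP[yY ya] zN gyz.
have le_marks (S0 : {set {set T}}) u p : S :\ s \subset S0 ->
    [set a; b] \notin path_edges u p -> marks ([set a; b] |: S :\ s) u p <= marks S0 u p.
  move=> /subsetP sub nab; apply: sub_in_count => E Ep /=; rewrite in_setU1.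
  by case/predU1P=> [EE|/sub //]; rewrite -EE Ep in nab.
case: (boolP (z \in Y)) zN => [_ za|zY _].
  have [-> ->] := side_exit forest_g gab ya za gyz; split.
    rewrite disjoints_subset; apply/subsetP => w wab; rewrite in_setC in_setI negb_and.
    by rewrite (side_disjoint forest_g gab wab) orbT.
  move=> p gp; apply: leq_trans (sh _ gp); apply: le_marks => //.
  by move: gp; rewrite spath_cons => /and3P[_ _ na]; apply: notin_path_edges.
have [disj shS] := confS y z yY zY gyz; split.
  by apply: disjointWr disj; apply: subsetIl.
move=> p gp; apply: leq_trans (shS _ gp); apply: le_marks; first exact: subsetDl.
apply: notin_path_edges; apply/negP => /(spath_side gp).
by rewrite (disjointFl disj aY).
Qed.

(* Starting from all vertices, cut the current region at an edge inside it and
   keep the side from which the other one looks shallow, after making that edge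
   the representative of its color. *)
Lemma exists_shallow_root : 0 < #|T| ->
  exists S v, selects g f S /\ forall x, shallow g S r v x.
Proof.
move=> T_gt0; have [S0 selS0] := exists_selects g f.
suff shrink n S (Y : {set T}) : #|Y| < n -> 0 < #|Y| -> selects g f S -> confined S Y ->
    exists S' v, selects g f S' /\ forall x, shallow g S' r v x.
  by apply: (shrink _ S0 setT (ltnSn _)); rewrite ?cardsT // => y z _; rewrite inE.
elim: n S Y => // n IHn S Y le_n Y_gt0 selS confS.
case: (pickP [pred ab : T * T | [&& ab.1 \in Y, ab.2 \in Y & g ab.1 ab.2]])
    => [[a b] /and3P[/= aY bY gab]|no_edge]; last first.
  case/card_gt0P: Y_gt0 => v vY; exists S, v; split=> // x p gp.
  have gvx : g v x by move: gp; rewrite spath_cons => /and3P[].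
  have := no_edge (v, x); rewrite /= vY gvx andbT => /negbT xY.
  by have [_ ->] := confS v x vY xY gvx.
wlog [s sS [fs sh]] : a b aY bY gab / exists2 s, s \in S &
    f s = f [set a; b] /\ shallow g (S :\ s) r a b.
  move=> cut; have Eg : [set a; b] \in edge_set g by rewrite mem_edge_set.
  have [s sS fs] : exists2 s, s \in S & f s = f [set a; b] by case: selS => _ _; apply.
  have [sh|sh] := swap_shallow selS sS gab fs; first by apply: (cut a b) => //; exists s.
  by apply: (cut b a) => //; [rewrite gS | exists s; rewrite // [[set b; a]]setUC].
apply: (IHn ([set a; b] |: S :\ s) (Y :&: side g b a)).
- rewrite ltnS in le_n; apply: leq_trans le_n; apply/proper_card/properP.
  split; first exact: subsetIl.
  by exists b; rewrite // in_setI bY (side_disjoint forest_g gab) ?mem_side.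
- by apply/card_gt0P; exists a; rewrite in_setI aY mem_side.
- by apply: selects_swap => //; rewrite mem_edge_set.
- exact: confined_swap.
Qed.

End ShallowRoot.

Lemma exists_center g k f : forest g -> 0 < #|T| -> 0 < k -> color_bounded g k f ->
  exists S v, [/\ S \subset edge_set g, #|S| = colors_used g f & center g k S v].
Proof.
move=> forest_g T_gt0 k_gt0 f_k.
have f_bounded : color_bounded g k.-1./2.*2.+2 f.
  by move=> u p /f_k/leq_trans; apply; lia.
have [S [v [selS sh]]] := exists_shallow_root forest_g f_bounded T_gt0.
have [SE inj _] := selS; exists S, v; split=> //; first exact: card_selects.
split=> [x p /sh|x p y q nxy gp gq]; first by lia.
have [u [t [gt <-]]] := spath_join forest_g gp gq nxy.
by have /andP[_ ut] := gt; apply: leq_trans (marks_le_colors ut inj) (f_k _ _ gt).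
Qed.

End Center.

(** * Peeling the leaves *)

Section Subtrees.
Variables (T : finType) (e : rel T).
Hypothesis forest_e : forest e.
Implicit Types (A B : {set T}) (u v w x y z : T) (p q : seq T) (E : {set T}).

Definition induced A : rel T := [rel x y | [&& x \in A, y \in A & e x y]].

Definition nbrs A x : {set T} := [set y in A | e x y].

Definition leaves A : {set T} := [set x in A | #|nbrs A x| == 1].

Definition peel A : {set T} := A :\: leaves A.

Definition subtree A : Prop :=
  0 < #|A| /\ {in A &, forall x y, connect (induced A) x y}.

Lemma induced_forest A : forest (induced A).
Proof.
split.
  split=> [x y|x]; rewrite /induced /= ?(forest_irr forest_e) ?andbF //.
  by rewrite (forest_sym forest_e) andbCA.
move=> c /andP[cyc uc]; case: forest_e => _; apply; rewrite /ucycle uc andbT.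
by apply: sub_cycle cyc => x y /and3P[].
Qed.

Lemma induced_sym A : symmetric (induced A).
Proof. exact: forest_sym (induced_forest A). Qed.

Lemma mem_nbrs A x y : x \in A -> (y \in nbrs A x) = induced A x y.
Proof. by move=> xA; rewrite inE /induced /= xA. Qed.

Lemma path_induced A x p : path (induced A) x p -> {subset p <= A}.
Proof.
elim: p x => //= y p IHp x /andP[/and3P[_ yA _] /IHp sA] z.
by rewrite inE => /predU1P[->|/sA].
Qed.

Lemma induced_subset A B : A \subset B -> subrel (induced A) (induced B).
Proof.
by move=> /subsetP AB x y /and3P[xA yA exy]; apply/and3P; split=> //; apply: AB.
Qed.

Lemma leaf_nbr A x y z : x \in leaves A -> induced A x y -> induced A x z -> y = z.
Proof.
rewrite inE => /andP[xA /cards1P[w nbrE]].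
by rewrite -!mem_nbrs // nbrE !inE => /eqP-> /eqP->.
Qed.

Lemma peel_subset A : peel A \subset A.
Proof. exact: subsetDl. Qed.

Lemma leaves_subset A : leaves A \subset A.
Proof. by apply/subsetP => x /setIdP[]. Qed.

Lemma mem_peel A x : (x \in peel A) = (x \in A) && (x \notin leaves A).
Proof. by rewrite in_setD andbC. Qed.

Lemma card_peel A : #|peel A| + #|leaves A| = #|A|.
Proof. by rewrite addnC -(cardsID (leaves A) A) (setIidPr (leaves_subset A)). Qed.

(* A path ending at an inner vertex can be continued along an edge other than the
   last one. *)
Lemma spath_extend A v x p : spath (induced A) v (x :: p) ->
  exists q, spath (induced A) v (x :: p ++ q) /\ last x (p ++ q) \in leaves A.
Proof.
have iF := induced_forest A; have [n le_n] := ubnP (#|T| - size p).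
elim: n p le_n => // n IHn p le_n gp.
case: (boolP (last x p \in leaves A)) => [leaf|inner]; first by exists [::]; rewrite cats0.
case/lastP def_p: {1}(x :: p) => [//|q z]; have gq := gp; rewrite def_p in gq.
have zE : last x p = z by rewrite -(last_cons v) def_p last_rcons.
rewrite {}zE in inner; move: (gq); rewrite spath_rcons => /and3P[_ iqz _].
have [qA zA _] := and3P iqz.
have [w izw nw] : exists2 w, induced A z w & w != last v q.
  case: (pickP [pred w in nbrs A z | w != last v q]) => [w /andP[/=]|none].
    by rewrite mem_nbrs // => izw nw; exists w.
  case/negP: inner; rewrite inE zA; apply/cards1P; exists (last v q).
  apply/setP => w; rewrite in_set1; have := none w; rewrite /= mem_nbrs //.
  by case: eqP => [->|_]; rewrite ?andbT // induced_sym.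
have wN : w \notin v :: x :: p.
  by rewrite def_p; apply: contra nw => wq; apply/eqP; apply: spath_back_edge gq wq izw.
have gpw : spath (induced A) v (x :: rcons p w).
  by rewrite -rcons_cons spath_rcons gp wN def_p last_rcons izw.
have [|r [gr leaf]] := IHn (rcons p w) _ gpw.
  by have := spath_size gpw; rewrite /= size_rcons; move: le_n; move: #|T| => c; lia.
by exists (w :: r); rewrite -cat_rcons.
Qed.

Lemma spath_interior A v p x q : spath (induced A) v (rcons p x ++ q) -> q != [::] ->
  x \notin leaves A.
Proof.
case: q => // y q + _; rewrite spath_cat spath_rcons spath_cons last_rcons.
case/and3P=> /and3P[_ ipx _] /and3P[ixy _ _] /hasPn/(_ y (mem_head _ _)) yN.
rewrite induced_sym in ipx; apply: contra yN => leaf.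
by rewrite (leaf_nbr leaf ixy ipx) -rcons_cons mem_rcons inE mem_last orbT.
Qed.

Lemma peel_spath A v p : v \in peel A -> last v p \in peel A ->
  spath (induced A) v p -> spath (induced (peel A)) v p.
Proof.
move=> vP lP gp; have /andP[ip up] := gp; rewrite /spath up andbT.
have {gp lP up} sP : {subset p <= peel A}.
  move=> x xp; case: (eqVneq x (last v p)) => [->//|nx].
  rewrite mem_peel (path_induced ip) //; move: nx gp.
  case/splitPr: xp => p1 p2; rewrite -cat_rcons => nx gp.
  apply: (spath_interior gp); apply: contra nx => /eqP->.
  by rewrite cats0 last_rcons.
elim: p v vP ip sP => //= y p IHp v vP /andP[/and3P[_ _ evy] ip] sP.
have yP := sP y (mem_head _ _); rewrite IHp // ?andbT; first exact/and3P.
by move=> x xp; apply: sP; rewrite inE xp orbT.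
Qed.

Section Subtree.
Variable A : {set T}.
Hypothesis tree_A : subtree A.

Lemma subtree_spath x y : x \in A -> y \in A ->
  exists2 p, spath (induced A) x p & y = last x p.
Proof. by move=> xA yA; case: tree_A => _ conn; apply: connect_spath; apply: conn. Qed.

Lemma subtree_nbr x : 1 < #|A| -> x \in A -> exists y, induced A x y.
Proof.
move=> A_gt1 xA; have [y yA nyx] : exists2 y, y \in A & y != x.
  move: A_gt1; rewrite (cardsD1 x) xA ltnS => /card_gt0P[y].
  by rewrite !inE => /andP[nyx yA]; exists y.
have [[|z p]] := subtree_spath xA yA; first by move=> _ E; rewrite E eqxx in nyx.
by rewrite spath_cons => /and3P[ixz _ _] _; exists z.
Qed.

Lemma leaf_nbr_peel x y : 2 < #|A| -> x \in leaves A -> induced A x y -> y \in peel A.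
Proof.
move=> A_gt2 leaf_x ixy; have [xA yA _] := and3P ixy.
rewrite mem_peel yA; apply/negP => leaf_y.
have [z zA nz] : exists2 z, z \in A & z \notin [set x; y].
  apply/subsetPn; apply: contraL A_gt2 => /subset_leq_card le.
  by rewrite -leqNgt (leq_trans le) // cards2; case: (_ != _).
have [[|a [|b p]] gp zE] := subtree_spath xA zA; first by rewrite zE set21 in nz.
  move: gp; rewrite spath_cons => /and3P[ixa _ _].
  by rewrite zE /= (leaf_nbr leaf_x ixa ixy) set22 in nz.
move: gp; rewrite !spath_cons => /and3P[ixa /and3P[iab _ _]].
rewrite (leaf_nbr leaf_x ixa ixy) in iab *; rewrite induced_sym in ixy.
by rewrite (leaf_nbr leaf_y ixy iab) !inE eqxx orbT.
Qed.

Lemma subtree_peel : 2 < #|A| -> subtree (peel A).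
Proof.
move=> A_gt2; split=> [|x y xP yP].
  have [/card_gt0P[x xA] _] := tree_A; apply/card_gt0P.
  case: (boolP (x \in leaves A)) => [leaf|inner]; last by exists x; rewrite mem_peel xA.
  by have [y ixy] := subtree_nbr (ltnW A_gt2) xA; exists y; apply: leaf_nbr_peel ixy.
have [xA yA] := (subsetP (peel_subset A) x xP, subsetP (peel_subset A) y yP).
have [p gp yE] := subtree_spath xA yA; apply/connectP; exists p => //.
by rewrite yE in yP; case/andP: (peel_spath xP yP gp).
Qed.

Lemma subtree_has_leaf : 1 < #|A| -> 0 < #|leaves A|.
Proof.
move=> A_gt1; have [/card_gt0P[x xA] _] := tree_A.
have [y ixy] := subtree_nbr A_gt1 xA; have gp : spath (induced A) x [:: y].
  by rewrite /spath /= ixy inE (forest_neq (induced_forest A) ixy).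
by have [q [_ leaf]] := spath_extend gp; apply/card_gt0P; exists (last y ([::] ++ q)).
Qed.

Lemma subtree_edge v E : v \in A -> E \in edge_set (induced A) ->
  exists p z, spath (induced A) v (rcons p z) /\ E = [set last v p; z].
Proof.
move=> vA /edge_setP[y [z [iyz ->]]]; have [yA zA _] := and3P iyz.
have [p gp yE] := subtree_spath vA yA.
case: (boolP (z \in v :: p)) => [zp|nzp]; last first.
  by exists p, z; rewrite spath_rcons gp -yE iyz.
case/lastP: p gp yE zp => [|p w] gp; rewrite ?last_rcons => yE zp.
  by move: zp iyz; rewrite yE inE => /eqP->; rewrite (forest_irr (induced_forest A)).
rewrite -yE in gp zp; exists p, y; split=> //.
by rewrite (spath_back_edge (induced_forest A) gp zp iyz) setUC.
Qed.

Lemma subtree_spath_to v z : v \in A -> z \in A :\ v ->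
  exists p, spath (induced A) v (rcons p z).
Proof.
rewrite in_setD1 => vA /andP[nz zA]; have [p gp zE] := subtree_spath vA zA.
case/lastP: p gp zE => [|p y] gp; first by move=> zE; rewrite zE eqxx in nz.
by rewrite last_rcons => ->; exists p.
Qed.

Lemma edge_set_parent v : v \in A ->
  edge_set (induced A) = [set parent_edge (induced A) v z | z in A :\ v].
Proof.
move=> vA; have iF := induced_forest A.
apply/setP => E; apply/idP/imsetP => [/(subtree_edge vA)[p [z [gp ->]]]|[z zA ->]].
  exists z; last by rewrite (parent_edgeE iF gp).
  move: gp; rewrite spath_rcons inE negb_or in_setD1.
  by case/and3P=> _ /and3P[_ -> _] /andP[-> _].
have [p gp] := subtree_spath_to vA zA; rewrite (parent_edgeE iF gp).
by rewrite mem_edge_set; [move: gp; rewrite spath_rcons => /and3P[] | apply: induced_sym].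
Qed.

Lemma subtree_card_edges : #|edge_set (induced A)| = #|A|.-1.
Proof.
have [/card_gt0P[v vA] _] := tree_A; rewrite (edge_set_parent vA) card_in_imset.
  by rewrite [in RHS](cardsD1 v) vA.
move=> y z yA zA; have [p gp] := subtree_spath_to vA yA.
have [q gq] := subtree_spath_to vA zA.
exact: (parent_edge_inj (induced_forest A) gp gq).
Qed.

End Subtree.
End Subtrees.

Section PeelCenter.
Variables (T : finType) (e : rel T).
Hypothesis forest_e : forest e.
Implicit Types (A : {set T}) (u v w x y z : T) (p q : seq T) (S R : {set {set T}}).

Notation induced := (induced e).
Notation leaves := (leaves e).
Notation peel := (peel e).

Definition last_mark S v p : {set T} := last set0 [seq E <- path_edges v p | E \in S].

Lemma last_mark_in S v p : 0 < marks S v p ->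
  last_mark S v p \in path_edges v p /\ last_mark S v p \in S.
Proof.
rewrite /marks -size_filter /last_mark; case def_s: (filter _ _) => [|E s] // _.
have := mem_last E s; rewrite -[X in _ \in X]def_s mem_filter => /andP[].
by rewrite /= => -> ->.
Qed.

Lemma last_mark_cat S v p q : 0 < marks S (last v p) q ->
  last_mark S v (p ++ q) = last_mark S (last v p) q.
Proof.
rewrite /marks -size_filter /last_mark path_edges_cat filter_cat last_cat.
by case: [seq E <- path_edges (last v p) q | _].
Qed.

Lemma marks_setD_last S R v p : 0 < marks S v p -> last_mark S v p \in R ->
  marks (S :\: R) v p < marks S v p.
Proof.
move=> /last_mark_in[+ inS] inR; move: (last_mark _ _ _) inS inR => E ES ER.
rewrite /marks => /splitPr[s1 s2]; rewrite !count_cat /= in_setD ES ER /= add0n addnS ltnS.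
by apply: leq_add; apply: sub_count => F /=; rewrite in_setD => /andP[].
Qed.

Section InnerMarks.
Variables (A : {set T}) (k : nat) (S : {set {set T}}) (v : T).
Hypotheses (k_gt2 : 2 < k) (center_v : center (induced A) k S v).

Let iF : forest (induced A) := induced_forest forest_e A.

Definition last_marks : {set {set T}} :=
  [set last_mark S v (tree_path (induced A) v z) | z in leaves A :\ v].

Definition inner_marks : {set {set T}} := S :\: last_marks.

Lemma card_inner_marks : #|S| <= #|inner_marks| + #|leaves A :\ v|.
Proof.
rewrite -(cardsID last_marks S) addnC leq_add2l.
apply: leq_trans (leq_imset_card _ _); apply: subset_leq_card; exact: subsetIr.
Qed.

Lemma marks_extend p q : spath (induced A) v (p ++ q) ->
  0 < marks inner_marks (last v p) q ->
  exists q', spath (induced A) v (p ++ q ++ q') /\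
    marks inner_marks (last v p) q < marks S (last v p) (q ++ q').
Proof.
move=> gp q_marked; have [q' [gq leaf]] : exists q', spath (induced A) v (p ++ q ++ q') /\
    last v (p ++ q ++ q') \in leaves A :\ v.
  case def_pq: (p ++ q) gp => [|x t] gp.
    by move: q_marked; have -> : q = [::] by case: (p) def_pq.
  have [q' [gq leaf]] := spath_extend forest_e gp.
  exists q'; rewrite catA def_pq; split=> //; rewrite in_setD1 leaf andbT.
  move: gq; rewrite spath_cons => /and3P[_ _]; apply: contraNneq => <-.
  exact: (mem_last x (t ++ q')).
exists q'; split=> //; have S_marked : 0 < marks S (last v p) (q ++ q').
  apply: leq_trans (marks_subset _ _ (subsetDl _ _ : inner_marks \subset S)).
  by rewrite marks_cat addn_gt0 q_marked.
apply: leq_ltn_trans (marks_setD_last S_marked _ : marks inner_marks _ _ < _).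
  by rewrite marks_cat leq_addr.
apply/imsetP; exists (last v (p ++ q ++ q')) => //.
by rewrite (tree_pathE iF gq) (last_mark_cat S_marked).
Qed.

Lemma inner_marks_half x p : spath (induced A) v (x :: p) ->
  (marks inner_marks x p).*2 < k - 2.
Proof.
move=> gp; case: (posnP (marks inner_marks x p)) => [->|p_marked]; first by lia.
have [q [gq lt]] := marks_extend (p := [:: x]) gp p_marked.
by have := center_v.1 _ _ gq; move: lt => /=; lia.
Qed.

Lemma inner_center : center (induced A) (k - 2) inner_marks v.
Proof.
split=> [|x p y q nxy gp gq]; first exact: inner_marks_half.
have [half_p half_q] := (inner_marks_half gp, inner_marks_half gq).
have le_cons z t : marks inner_marks v (z :: t) <= (marks inner_marks z t).+1.
  by rewrite marks_cons -add1n leq_add2r leq_b1.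
case: (posnP (marks inner_marks v (x :: p))) => [->|p_marked].
  by have := le_cons y q; lia.
case: (posnP (marks inner_marks v (y :: q))) => [->|q_marked].
  by have := le_cons x p; lia.
have [p' [gp' lt_p]] := marks_extend (p := [::]) gp p_marked.
have [q' [gq' lt_q]] := marks_extend (p := [::]) gq q_marked.
have le_k : marks S v ((x :: p) ++ p') + marks S v ((y :: q) ++ q') <= k.
  exact: center_v.2 nxy gp' gq'.
by rewrite [last v _]/= in lt_p lt_q; lia.
Qed.

Hypotheses (tree_A : subtree e A) (vA : v \in A) (S_edges : S \subset edge_set (induced A)).

Lemma inner_marks_peel E : E \in inner_marks -> (v \in E -> v \notin leaves A) ->
  E \in edge_set (induced (peel A)).
Proof.
rewrite in_setD => /andP[not_last ES] vE.
have [p [z [gp EE]]] := subtree_edge forest_e tree_A vA (subsetP S_edges E ES).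
move: (gp); rewrite spath_rcons => /and3P[_ ipz]; rewrite inE negb_or => /andP[nzv _].
have [lA zA elz] := and3P ipz.
have inner_z : z \notin leaves A.
  apply: contra not_last => leaf; apply/imsetP; exists z; first by rewrite in_setD1 nzv.
  have := tree_pathE iF gp; rewrite last_rcons => ->.
  by rewrite /last_mark path_edges_rcons filter_rcons -EE ES last_rcons.
have inner_last : last v p \notin leaves A.
  case/lastP: p gp EE {ipz lA elz} => [|p w] gp EE; first by rewrite vE // EE set21.
  by rewrite last_rcons; rewrite -cats1 in gp; apply: (spath_interior forest_e gp).
rewrite EE mem_edge_set; last exact: induced_sym.
by rewrite /induced /= !mem_peel lA zA inner_z inner_last.
Qed.

Lemma inner_marks_peel_center :
  v \notin leaves A -> inner_marks \subset edge_set (induced (peel A)).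
Proof. by move=> inner; apply/subsetP => E ES; apply: inner_marks_peel. Qed.

Section LeafCenter.
Variable w : T.
Hypotheses (A_gt2 : 2 < #|A|) (leaf_v : v \in leaves A) (ivw : induced A v w).

Lemma inner_marks_peel_leaf :
  inner_marks :\ [set v; w] \subset edge_set (induced (peel A)).
Proof.
apply/subsetP => E /setD1P[nE ES]; apply: (inner_marks_peel ES) => vE.
case/negP: nE; move: ES; rewrite in_setD => /andP[_ /(subsetP S_edges)/edge_setP].
case=> x [y [ixy EE]]; move: vE ixy; rewrite EE => /set2P[]<- ixy.
  by rewrite (leaf_nbr leaf_v ivw ixy).
by rewrite induced_sym // in ixy; rewrite (leaf_nbr leaf_v ivw ixy) setUC.
Qed.

(* The edge vw no longer counts, so each path from w has at most as many marks as
   the path from v through w has after its first edge. *)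
Lemma inner_center_leaf :
  center (induced (peel A)) (k - 2) (inner_marks :\ [set v; w]) w.
Proof.
have wP := leaf_nbr_peel forest_e tree_A A_gt2 leaf_v ivw.
have half x p : spath (induced (peel A)) w (x :: p) ->
    (marks (inner_marks :\ [set v; w]) w (x :: p)).*2 < k - 2.
  move=> gp; apply: leq_ltn_trans (inner_marks_half (x := w) (p := x :: p) _).
    by rewrite leq_double; apply: marks_subset; apply: subsetDl.
  rewrite spath_cons ivw (sub_spath _ gp); last exact: induced_subset (peel_subset _ _).
  case/andP: gp => /path_induced sub _; apply/negP => /predU1P[vw|/sub].
    by move: wP; rewrite -vw mem_peel leaf_v andbF.
  by rewrite mem_peel leaf_v andbF.
split=> [x p /half|x p y q _ /half + /half]; last by lia.
by rewrite marks_cons; lia.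
Qed.

End LeafCenter.
End InnerMarks.

Definition center_bound A k m : Prop := forall S v,
  v \in A -> S \subset edge_set (induced A) -> center (induced A) k S v -> #|S| <= m.

Lemma center_bound_peel A k m : subtree e A -> 2 < #|A| -> 2 < k ->
  center_bound (peel A) (k - 2) m -> center_bound A k (m + #|leaves A|).
Proof.
move=> tree_A A_gt2 k_gt2 bound S v vA S_edges center_v.
apply: leq_trans (card_inner_marks A S v) _.
case: (boolP (v \in leaves A)) => [leaf|inner]; last first.
  apply: leq_add; last by apply: subset_leq_card; apply: subsetDl.
  apply: (bound _ v) (inner_marks_peel_center tree_A vA S_edges inner) _.
    by rewrite mem_peel vA.
  apply: center_sub (induced_subset (peel_subset e A)) (subxx _) _.
  exact: inner_center.
have [w ivw] := subtree_nbr tree_A (ltnW A_gt2) vA.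
rewrite (cardsD1 v (leaves A)) leaf addnA leq_add2r.
rewrite (cardsD1 [set v; w] (inner_marks A S v)) addnC.
apply: leq_add (leq_b1 _).
apply: (bound _ w) (inner_marks_peel_leaf tree_A vA S_edges leaf ivw) _.
  exact: leaf_nbr_peel ivw.
exact: inner_center_leaf.
Qed.

End PeelCenter.

(** * Values of the color connection number *)

Section Values.
Variables (T : finType) (e : rel T).
Hypothesis forest_e : forest e.
Implicit Types (A B : {set T}) (u v w x y z : T) (p q : seq T) (S : {set {set T}}).
Implicit Type f : {set T} -> nat.

Notation induced := (induced e).
Notation nbrs := (nbrs e).
Notation leaves := (leaves e).
Notation peel := (peel e).
Notation subtree := (subtree e).
Notation center_bound := (center_bound e).

Definition colorable A k m : Prop :=
  exists f, color_bounded (induced A) k f /\ m <= colors_used (induced A) f.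

Definition cc_value A k m : Prop := center_bound A k m /\ colorable A k m.

Definition maxdeg A : nat := \max_(x in A) #|nbrs A x|.

Lemma mem_edge_induced A x y : ([set x; y] \in edge_set (induced A)) = induced A x y.
Proof. by apply: mem_edge_set; apply: induced_sym. Qed.

Lemma colors_used_ge (g : rel T) f (s : seq nat) : uniq s ->
  {in s, forall c, exists2 E, E \in edge_set g & f E = c} -> size s <= colors_used g f.
Proof.
move=> us sub; apply: uniq_leq_size us _ => c /sub[E Eg <-].
by rewrite mem_undup map_f // mem_enum.
Qed.

Lemma colorable_leq A k k' m : k <= k' -> colorable A k m -> colorable A k' m.
Proof.
by move=> kk' [f [f_k f_m]]; exists f; split=> // u p /f_k/leq_trans; apply.
Qed.

Section FreshLeaves.
Variables (A : {set T}) (f : {set T} -> nat).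

Definition fresh : nat := (\max_E f E).+1.

Definition fresh_leaves (E : {set T}) : nat :=
  if [pick z in leaves A | z \in E] is Some z then fresh + enum_rank z else f E.

Lemma fresh_leaves_peel E : E \in edge_set (induced (peel A)) -> fresh_leaves E = f E.
Proof.
case/edge_setP=> x [y [/and3P[xP yP _] ->]]; rewrite /fresh_leaves.
case: pickP => // z /andP[leaf]; move: xP yP; rewrite !mem_peel.
by move=> /andP[_ nx] /andP[_ ny] /set2P[]zE; rewrite -zE leaf in nx ny.
Qed.

Lemma fresh_leaves_bounded k : 2 < k -> color_bounded (induced (peel A)) (k - 2) f ->
  color_bounded (induced A) k fresh_leaves.
Proof.
move=> k_gt2 f_k u p gp; rewrite path_colorsE.
case: p gp => [|x p] gp; first by rewrite /=; lia.
case/lastP: p gp => [|p y] gp; first by rewrite /=; lia.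
have [gxp inner_x inner_last] :
    [/\ spath (induced A) x p, x \notin leaves A & last x p \notin leaves A].
  split.
  - by move: gp; rewrite spath_cons spath_rcons => /and3P[_ /andP[]].
  - by apply: (spath_interior forest_e (p := [::]) (q := rcons p y) gp); case: (p).
  apply: (spath_interior forest_e (v := u) (p := belast x p) (q := [:: y])) => //.
  by rewrite -lastI cats1.
have gP : spath (induced (peel A)) x p.
  have /andP[ip _] := gp; apply: peel_spath; rewrite ?mem_peel ?inner_x ?inner_last //.
    by rewrite (path_induced ip) ?mem_head.
  by rewrite (path_induced ip) // -rcons_cons mem_rcons inE mem_last orbT.
have colE : map fresh_leaves (path_edges x p) = map f (path_edges x p).
  apply/eq_in_map => E Ep; apply: fresh_leaves_peel.
  by case/andP: gP => /path_edges_sub sub _; apply: sub.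
have := f_k _ _ gP; rewrite path_colorsE => f_p.
rewrite path_edges_cons path_edges_rcons map_cons map_rcons colE.
by apply: leq_trans (size_undup_ends _ _ _) _; lia.
Qed.

Hypotheses (tree_A : subtree A) (A_gt2 : 2 < #|A|).

Lemma fresh_leaves_leaf z y : z \in leaves A -> induced A z y ->
  fresh_leaves [set z; y] = fresh + enum_rank z.
Proof.
move=> leaf izy; have := leaf_nbr_peel forest_e tree_A A_gt2 leaf izy.
rewrite mem_peel => /andP[_ inner]; rewrite /fresh_leaves.
case: pickP => [w /andP[leaf_w /set2P[-> //|wE]]|/(_ z)].
  by rewrite -wE leaf_w in inner.
by rewrite leaf set21.
Qed.

Lemma fresh_leaves_used :
  colors_used (induced (peel A)) f + #|leaves A| <= colors_used (induced A) fresh_leaves.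
Proof.
pose old := undup [seq f E | E <- enum (edge_set (induced (peel A)))].
pose new := [seq fresh + enum_rank z | z <- enum (leaves A)].
have -> : colors_used (induced (peel A)) f + #|leaves A| = size (old ++ new).
  by rewrite size_cat size_map -cardE.
apply: colors_used_ge => [|c].
  rewrite cat_uniq undup_uniq map_inj_uniq ?enum_uniq ?andbT /=; last first.
    by move=> x y /addnI/ord_inj/enum_rank_inj.
  apply/hasPn => _ /mapP[z _ ->]; rewrite mem_undup; apply/mapP => -[E _ Ef].
  have : f E <= \max_E f E by apply: leq_bigmax.
  by rewrite -Ef /fresh addSn ltnNge leq_addr.
rewrite mem_cat mem_undup => /orP[]/mapP[].
  move=> E; rewrite mem_enum => EP ->; exists E; last exact: fresh_leaves_peel.
  case/edge_setP: EP => x [y [ixy ->]]; rewrite mem_edge_induced.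
  exact: induced_subset (peel_subset e A) _ _ ixy.
move=> z; rewrite mem_enum => leaf ->.
have zA := subsetP (leaves_subset e A) z leaf.
have [y izy] := subtree_nbr tree_A (ltnW A_gt2) zA; exists [set z; y].
  by rewrite mem_edge_induced.
exact: fresh_leaves_leaf.
Qed.

End FreshLeaves.

Lemma cc_value_peel A k m : subtree A -> 2 < #|A| -> 2 < k ->
  cc_value (peel A) (k - 2) m -> cc_value A k (m + #|leaves A|).
Proof.
move=> tree_A A_gt2 k_gt2 [bound [f [f_k f_m]]]; split; first exact: center_bound_peel.
exists (fresh_leaves A f); split; first exact: fresh_leaves_bounded.
by apply: leq_trans (fresh_leaves_used f tree_A A_gt2); rewrite leq_add2r.
Qed.

Section Components.
Variables (A : {set T}) (v : T).

Let h := del_vertex (induced A) v.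

Let h_sym : connect_sym h.
Proof. by apply: sym_connect_sym; apply: del_vertex_sym; apply: induced_sym. Qed.

Definition component_color (E : {set T}) : nat :=
  if [pick z in E | z != v] is Some z then enum_rank (root h z) else 0.

Lemma component_colorE x y : induced A x y -> x != v ->
  component_color [set x; y] = enum_rank (root h x).
Proof.
move=> ixy nx; rewrite /component_color; case: pickP => [z|/(_ x)]; last first.
  by rewrite set21 nx.
case/andP=> /set2P[]-> // ny; congr (val (enum_rank _)).
by apply/esym/(rootP h_sym)/connect1; rewrite /h /del_vertex /= ixy nx.
Qed.

Lemma component_color_path x p : path (induced A) x p -> v \notin x :: p ->
  {subset map component_color (path_edges x p) <= [:: val (enum_rank (root h x))]}.
Proof.
elim: p x => //= y p IHp x /andP[ixy ip]; rewrite inE negb_or eq_sym => /andP[nx nv] c.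
have ny : y != v by apply: contraNneq nv => ->; rewrite mem_head.
have rootE : root h x = root h y.
  by apply/(rootP h_sym)/connect1; rewrite /h /del_vertex /= ixy nx.
rewrite inE => /predU1P[->|]; first by rewrite component_colorE // inE.
by move=> /(IHp _ ip nv); rewrite rootE.
Qed.

Lemma component_color_from p : spath (induced A) v p ->
  exists c, {subset map component_color (path_edges v p) <= [:: c]}.
Proof.
case: p => [|y p]; first by exists 0.
rewrite spath_cons => /and3P[ivy /andP[ip _] nv].
exists (enum_rank (root h y) : nat) => c; rewrite /= inE => /predU1P[->|]; last first.
  exact: component_color_path.
rewrite setUC component_colorE ?inE //; first by rewrite induced_sym.
by apply: contraNneq nv => ->; rewrite mem_head.
Qed.

Lemma component_color_bounded : color_bounded (induced A) 2 component_color.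
Proof.
move=> u p gp; rewrite path_colorsE.
case: (boolP (v \in u :: p)) => [vp|nv]; last first.
  have /andP[ip _] := gp.
  exact: leq_trans (size_undup_subset (component_color_path ip nv)) _.
case/splitPl: vp gp => p1 p2 vE; rewrite spath_cat vE => /and3P[gp1 gp2 _].
have gp1_rev : spath (induced A) v (rev (belast u p1)).
  by rewrite -{1}vE spath_rev //; apply: induced_sym.
have [[c1 sub1] [c2 sub2]] := (component_color_from gp1_rev, component_color_from gp2).
apply: (size_undup_subset (t := [:: c1; c2])) => c.
rewrite path_edges_cat vE map_cat mem_cat => /orP[c_p1|/sub2].
  have := sub1 c; rewrite -{1}vE path_edges_rev map_rev mem_rev => /(_ c_p1).
  by rewrite !inE => ->.
by rewrite !inE => ->; rewrite orbT.
Qed.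

Lemma component_color_used : v \in A ->
  #|nbrs A v| <= colors_used (induced A) component_color.
Proof.
move=> vA; rewrite cardE -(size_map (fun w => enum_rank (root h w) : nat)).
apply: colors_used_ge => [|c /mapP[w]].
  rewrite map_inj_in_uniq ?enum_uniq // => x y; rewrite !mem_enum !mem_nbrs //.
  move=> ivx ivy /ord_inj/enum_rank_inj/(rootP h_sym).
  exact: (forest_branch (induced_forest forest_e A)).
rewrite mem_enum mem_nbrs // => ivw ->; rewrite induced_sym // in ivw.
exists [set w; v]; first by rewrite mem_edge_induced.
by rewrite component_colorE // (forest_neq (induced_forest forest_e A) ivw).
Qed.

End Components.

Lemma colorable_maxdeg A : 0 < #|A| -> colorable A 2 (maxdeg A).
Proof.
move=> A_gt0; have [v vA ->] : {v | v \in A & maxdeg A = #|nbrs A v|}.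
  exact: eq_bigmax_cond.
exists (component_color A v); split; first exact: component_color_bounded.
exact: component_color_used.
Qed.

Lemma maxdeg_gt0 A : (0 < maxdeg A) = (edge_set (induced A) != set0).
Proof.
apply/idP/set0Pn => [|[E /edge_setP[x [y [ixy _]]]]].
  rewrite lt0n => nz; have {nz} : ~~ [forall x in A, #|nbrs A x| <= 0].
    apply: contra nz => /forall_inP no; rewrite -leqn0; apply/bigmax_leqP; exact: no.
  rewrite negb_forall_in => /exists_inP[x xA]; rewrite -ltnNge => /card_gt0P[y].
  by rewrite mem_nbrs // => ixy; exists [set x; y]; rewrite mem_edge_induced.
have [xA _ _] := and3P ixy; apply: (@leq_trans #|nbrs A x|).
  by apply/card_gt0P; exists y; rewrite mem_nbrs.
exact: leq_bigmax_cond.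
Qed.

Lemma colorable_one A : colorable A 1 (minn 1 (maxdeg A)).
Proof.
exists (fun=> 0); split=> [u p gp|].
  rewrite path_colorsE; apply: (size_undup_subset (t := [:: 0])) => c.
  by case/mapP=> E _ ->; rewrite inE.
case: (posnP (maxdeg A)) => [->//|]; rewrite maxdeg_gt0 => /set0Pn[E EA].
apply: leq_trans (geq_minl _ _) _; apply: (colors_used_ge (s := [:: 0])) => // c.
by rewrite inE => /eqP->; exists E.
Qed.

Lemma center_le2_star A k S v E : subtree A -> k <= 2 -> v \in A ->
  S \subset edge_set (induced A) -> center (induced A) k S v -> E \in S ->
  exists2 z, induced A v z & E = [set v; z].
Proof.
move=> tree_A k_le2 vA S_edges [half _] ES.
have [p [z [gp EE]]] := subtree_edge forest_e tree_A vA (subsetP S_edges E ES).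
case: p gp EE => [|x p] gp EE; first by exists z; case/andP: gp => /andP[].
have := half x (rcons p z) gp; rewrite /marks path_edges_rcons.
rewrite -cats1 count_cat /= -EE ES; lia.
Qed.

Lemma center_bound_maxdeg A k : subtree A -> k <= 2 -> center_bound A k (maxdeg A).
Proof.
move=> tree_A k_le2 S v vA S_edges center_v.
apply: (@leq_trans #|nbrs A v|); last exact: leq_bigmax_cond.
apply: leq_trans (leq_imset_card (fun w => [set v; w]) _).
apply: subset_leq_card; apply/subsetP => E ES.
have [z ivz EE] := center_le2_star tree_A k_le2 vA S_edges center_v ES.
by apply/imsetP; exists z; rewrite ?mem_nbrs.
Qed.

Lemma center_bound_one A : subtree A -> center_bound A 1 1.
Proof.
move=> tree_A S v vA S_edges center_v; rewrite leqNgt; apply/negP.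
have star := center_le2_star tree_A (isT : 1 <= 2) vA S_edges center_v.
case/card_gt1P=> E [F [ES FS nEF]]; have [[x ivx EE] [y ivy FE]] := (star E ES, star F FS).
have nxy : x != y by apply: contraNneq nEF => xy; rewrite EE FE xy.
have edge_spath z : induced A v z -> spath (induced A) v [:: z].
  by move=> ivz; rewrite /spath /= ivz inE (forest_neq (induced_forest forest_e A) ivz).
have := center_v.2 _ _ _ _ nxy (edge_spath x ivx) (edge_spath y ivy).
by rewrite !marks_cons -EE -FE ES FS.
Qed.

Lemma cc_value_two A : subtree A -> cc_value A 2 (maxdeg A).
Proof.
move=> tree_A; split; first exact: center_bound_maxdeg.
by apply: colorable_maxdeg; case: tree_A.
Qed.

Lemma cc_value_one A : subtree A -> cc_value A 1 (minn 1 (maxdeg A)).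
Proof.
move=> tree_A; split; last exact: colorable_one.
move=> S v vA S_edges center_v; rewrite leq_min (center_bound_one tree_A vA S_edges) //.
exact: center_bound_maxdeg center_v.
Qed.

Lemma center_two_card_le2 A S v : #|A| <= 2 -> center (induced A) 2 S v.
Proof.
move=> A_le2; have small (s : seq T) : uniq s -> {subset s <= A} -> size s <= 2.
  move=> us sA; apply: leq_trans A_le2; rewrite -(card_uniqP us).
  exact/subset_leq_card/subsetP.
split=> [x p|x p y q nxy].
  case/andP=> ip up; have : size [:: v, x & p] <= 2.
    apply: small => // z /predU1P[->|/(path_induced ip)//].
    by case/andP: ip => /and3P[].
  by case: p {ip up}.
rewrite !spath_cons => /and3P[ivx _ nvx] /and3P[ivy _ nvy].
have [[vA xA _] [_ yA _]] := (and3P ivx, and3P ivy).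
have /small : uniq [:: v; x; y].
  rewrite /= !inE nxy; move: nvx nvy; rewrite !inE !negb_or.
  by move=> /andP[-> _] /andP[-> _].
by move=> /(_ (ltac:(by move=> z; rewrite !inE => /or3P[]/eqP->))).
Qed.

Lemma cc_value_card_le2 A k m : #|A| <= 2 -> 1 < k -> cc_value A 2 m -> cc_value A k m.
Proof.
move=> A_le2 k_gt1 [bound col]; split; last exact: colorable_leq col.
by move=> S v vA S_edges _; apply: (bound S v) => //; apply: center_two_card_le2.
Qed.

End Values.

Section Trees.
Variables (T : finType) (e : rel T).
Hypothesis tree_e : is_tree e.
Implicit Type f : {set T} -> nat.

Lemma tree_forest : forest e.
Proof. by case: tree_e. Qed.

Lemma inducedT : induced e setT =2 e.
Proof. by move=> x y; apply/and3P/idP => [[]//|exy]; rewrite !inE. Qed.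

Lemma tree_subtree : subtree e setT.
Proof.
case: tree_e => T_gt0 _ conn _; split=> [|x y _ _]; first by rewrite cardsT.
by rewrite (eq_connect inducedT).
Qed.

Lemma edge_set_inducedT : edge_set (induced e setT) = edge_set e.
Proof.
by apply/setP => E; apply/edge_setP/edge_setP => -[x [y [exy ->]]];
  exists x, y; rewrite inducedT in exy *.
Qed.

Lemma spath_inducedT u p : spath (induced e setT) u p = spath e u p.
Proof. by rewrite /spath (eq_path inducedT). Qed.

Lemma color_connectionP k f : color_connection e k f <-> color_bounded e k f.
Proof.
case: tree_e => _ _ conn _; split=> [f_k u p gp|f_k].
  have [[q /and3P[eq /eqP lastq uq] col_q] _] := color_distP f (conn u (last u p)).
  have <- : q = p.
    by apply: (spath_unique tree_forest) gp lastq; rewrite /spath eq.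
  rewrite col_q; apply: leq_trans f_k; apply: leq_trans (leq_bigmax u).
  exact: (leq_bigmax (F := color_dist e f u) (last u p)).
apply/bigmax_leqP => u _; apply/bigmax_leqP => v _.
have [[q /and3P[eq _ uq] <-] _] := color_distP f (conn u v).
by apply: f_k; rewrite /spath eq.
Qed.

Lemma cc_value_is_cc k m : 0 < k -> cc_value e setT k m -> is_cc e k m.
Proof.
move=> k_gt0 [bound [f [f_k f_m]]]; have [T_gt0 _ _ _] := tree_e.
have col_f : color_connection e k f.
  by apply/color_connectionP => u p gp; apply: f_k; rewrite spath_inducedT.
have upper f' : color_connection e k f' -> colors_used e f' <= m.
  move=> /color_connectionP f'_k.
  have [S [v [S_edges <- center_v]]] := exists_center tree_forest T_gt0 k_gt0 f'_k.
  apply: (bound S v); rewrite ?inE ?edge_set_inducedT //.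
  by apply: center_sub center_v => // x y; rewrite inducedT.
split=> //; exists f => //; apply/eqP; rewrite eqn_leq upper //.
by rewrite /colors_used -edge_set_inducedT.
Qed.

Section EdgeList.
Variable es : seq (T * T).
Hypothesis edges_es : edge_list e es.

Let ends_inj : {in es &, injective (fun p : T * T => [set p.1; p.2])}.
Proof.
suff : uniq [seq [set p.1; p.2] | p <- es] by apply: uniq_map_inj_in.
by rewrite (perm_uniq edges_es) enum_uniq.
Qed.

Lemma size_edge_list : size es = #|T|.-1.
Proof.
have := perm_size edges_es; rewrite size_map -cardE => ->.
by rewrite -edge_set_inducedT (subtree_card_edges tree_forest tree_subtree) cardsT.
Qed.

Lemma edge_list_edge p : p \in es -> e p.1 p.2.
Proof.
move=> pes; rewrite -(mem_edge_set _ _ (forest_sym tree_forest)) -mem_enum.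
by rewrite -(perm_mem edges_es); apply: (map_f (fun p => [set p.1; p.2])).
Qed.

Lemma edge_list_darts :
  perm_eq (es ++ [seq (p.2, p.1) | p <- es]) (enum [pred p | e p.1 p.2]).
Proof.
have swapK : cancel (fun p : T * T => (p.2, p.1)) (fun p => (p.2, p.1)) by case.
apply: uniq_perm (enum_uniq _) _ => [|[x y]].
  rewrite cat_uniq map_inj_uniq; last exact: can_inj swapK.
  have -> : uniq es.
    apply: (@map_uniq _ _ (fun p => [set p.1; p.2])).
    by rewrite (perm_uniq edges_es) enum_uniq.
  rewrite andbT; apply/hasPn => _ /mapP[p pes ->]; apply/negP => qes.
  have := ends_inj pes qes (setUC _ _); case: p pes {qes} => x y /edge_list_edge /= exy [xy _].
  by rewrite xy (forest_irr tree_forest) in exy.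
rewrite mem_cat mem_enum inE /=; apply/orP/idP => [[/edge_list_edge//|]|exy].
  by case/mapP=> p /edge_list_edge + [-> ->]; rewrite (forest_sym tree_forest).
have : [set x; y] \in [seq [set p.1; p.2] | p <- es].
  by rewrite (perm_mem edges_es) mem_enum mem_edge_set //; apply: forest_sym tree_forest.
case/mapP=> -[a b] pes /eq_set2[][xE yE]; rewrite /= in xE yE.
  by left; rewrite xE yE.
by right; apply/mapP; exists (a, b); rewrite //= xE yE.
Qed.

End EdgeList.
End Trees.

(** * Removing the leaves one at a time *)

Section LeafRemoval.
Variables (T : finType) (e : rel T).
Hypothesis forest_e : forest e.
Implicit Types (A B : {set T}) (l u x y : T) (ns : seq T).

Notation nbrs := (nbrs e).
Notation leaves := (leaves e).
Notation peel := (peel e).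
Notation subtree := (subtree e).

Lemma nbrs_D1 A x y : nbrs (A :\ x) y = nbrs A y :\ x.
Proof. by apply/setP => z; rewrite !inE andbA. Qed.

Lemma nbrs_remove B l u x : nbrs B l = [set u] -> x \in B -> x != u ->
  nbrs (B :\ l) x = nbrs B x.
Proof.
move=> nbr_l xB nxu; rewrite nbrs_D1; apply/setP => y; rewrite in_setD1.
case: (eqVneq y l) => [->|//]; apply/esym/negbTE; apply: contra nxu.
by rewrite -in_set1 -nbr_l !inE xB (forest_sym forest_e) => /andP[].
Qed.

Lemma card_nbrs_remove B l u : l \in B -> nbrs B l = [set u] ->
  #|nbrs B u| = #|nbrs (B :\ l) u|.+1.
Proof.
move=> lB nbr_l; rewrite nbrs_D1 (cardsD1 l) inE lB (forest_sym forest_e).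
by have := set11 u; rewrite -nbr_l inE => /andP[_ ->].
Qed.

Lemma nbrs_gt0 A x : subtree A -> 1 < #|A| -> x \in A -> 0 < #|nbrs A x|.
Proof.
move=> tree_A A_gt1 xA; have [y ixy] := subtree_nbr tree_A A_gt1 xA.
by apply/card_gt0P; exists y; rewrite mem_nbrs.
Qed.

Lemma mem_leaves A x : subtree A -> 1 < #|A| ->
  (x \in leaves A) = (x \in A) && (#|nbrs A x| <= 1).
Proof.
move=> tree_A A_gt1; rewrite inE; case: (boolP (x \in A)) => //= xA.
by rewrite eqn_leq (nbrs_gt0 tree_A A_gt1 xA) andbT.
Qed.

(* The queue of the next round, when B is left of A: a vertex of [peel A] enters it
   when its degree drops to 1, and stays there if its degree drops to 0. *)
Definition frontier A B ns : Prop :=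
  uniq ns /\ forall x, (x \in ns) = (x \in peel A) && (#|nbrs B x| <= 1).

Section Round.
Variable A : {set T}.
Hypotheses (tree_A : subtree A) (A_gt2 : 2 < #|A|).

Lemma frontier_start : frontier A A [::].
Proof.
split=> // x; rewrite mem_peel -andbA.
case: (boolP (x \in A)) => //= xA; apply/esym/negbTE.
by rewrite (mem_leaves _ tree_A (ltnW A_gt2)) xA; case: (_ <= 1).
Qed.

Lemma frontier_leaves ns : frontier A (peel A) ns -> 2 < #|peel A| ->
  uniq ns /\ ns =i leaves (peel A).
Proof.
move=> [uns nsE] P_gt2; split=> // x; rewrite nsE mem_leaves //; last exact: ltnW.
exact: subtree_peel.
Qed.

Lemma leaf_single_nbr B l : peel A \subset B -> B \subset A -> l \in leaves A ->
  exists2 u, u \in peel A & nbrs B l = [set u].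
Proof.
move=> PB BA leaf; have lA := subsetP (leaves_subset e A) l leaf.
have [u ilu] := subtree_nbr tree_A (ltnW A_gt2) lA.
have uP := leaf_nbr_peel forest_e tree_A A_gt2 leaf ilu; exists u => //.
apply/setP => x; rewrite !inE; apply/andP/eqP => [[xB elx]|->].
  by apply: (leaf_nbr leaf _ ilu); rewrite /induced /= lA elx (subsetP BA).
by split; [apply: (subsetP PB) | case/and3P: ilu].
Qed.

Lemma frontier_remove B l u ns : peel A \subset B -> l \in B -> u \in peel A ->
  nbrs B l = [set u] -> frontier A B ns ->
  frontier A (B :\ l) (if #|nbrs (B :\ l) u| == 1 then rcons ns u else ns).
Proof.
move=> PB lB uP nbr_l [uns nsE].
have uN : (u \in ns) = (#|nbrs (B :\ l) u| == 0).
  by rewrite nsE uP (card_nbrs_remove lB nbr_l) ltnS leqn0.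
have otherE x : x != u ->
    (x \in ns) = (x \in peel A) && (#|nbrs (B :\ l) x| <= 1).
  move=> nxu; rewrite nsE; case: (boolP (x \in peel A)) => //= xP.
  by rewrite (nbrs_remove nbr_l) // (subsetP PB).
case: eqP => [deg_u|deg_u].
  split=> [|x]; first by rewrite rcons_uniq uN deg_u.
  rewrite mem_rcons inE; case: (eqVneq x u) => [->|/otherE //].
  by rewrite uP deg_u.
split=> // x; case: (eqVneq x u) => [->|/otherE //].
by rewrite uN uP /=; case: #|_| deg_u => [|[]].
Qed.

End Round.
End LeafRemoval.

(** * While programs for the random access machine *)

Inductive cmd :=
| CSkip
| CMov of loc & operand
| CAdd of loc & operand & operand
| CSub of loc & operand & operand
| CSeq of cmd & cmd
| CIf of operand & operand & cmd & cmd
| CWhile of operand & operand & cmd.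

Fixpoint code_size (c : cmd) : nat :=
  match c with
  | CSkip => 0
  | CMov _ _ | CAdd _ _ _ | CSub _ _ _ => 1
  | CSeq c1 c2 => code_size c1 + code_size c2
  | CIf _ _ c1 c2 => (code_size c1 + code_size c2).+2
  | CWhile _ _ c => (code_size c).+3
  end.

(* The guard of [CIf x y] and [CWhile x y] is x <= y; [q] is the address of the
   first instruction. *)
Fixpoint compile (q : nat) (c : cmd) : program :=
  match c with
  | CSkip => [::]
  | CMov l x => [:: IMov l x]
  | CAdd l x y => [:: IAdd l x y]
  | CSub l x y => [:: ISub l x y]
  | CSeq c1 c2 => compile q c1 ++ compile (q + code_size c1) c2
  | CIf x y c1 c2 =>
      IJle x y (q.+2 + code_size c2) :: compile q.+1 c2 ++
      IJmp (q.+2 + code_size c2 + code_size c1) :: compile (q.+2 + code_size c2) c1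
  | CWhile x y c =>
      [:: IJle x y q.+2, IJmp (q.+3 + code_size c) & rcons (compile q.+2 c) (IJmp q)]
  end.

Lemma size_compile q c : size (compile q c) = code_size c.
Proof.
elim: c q => //= [c1 IH1 c2 IH2|x y c1 IH1 c2 IH2|x y c IHc] q.
- by rewrite size_cat IH1 IH2.
- by rewrite size_cat /= IH1 IH2 addnS addnC.
- by rewrite size_rcons IHc.
Qed.

Definition located (P : program) (q : nat) (s : program) : Prop :=
  exists s1 s2, P = s1 ++ s ++ s2 /\ size s1 = q.

Lemma located_catl P q s t : located P q (s ++ t) -> located P q s.
Proof. by case=> s1 [s2 [-> <-]]; exists s1, (t ++ s2); rewrite -catA. Qed.

Lemma located_catr P q s t : located P q (s ++ t) -> located P (q + size s) t.
Proof. by case=> s1 [s2 [-> <-]]; exists (s1 ++ s), s2; rewrite size_cat !catA. Qed.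

Lemma located_cons P q i s :
  located P q (i :: s) -> onth P q = Some i /\ located P q.+1 s.
Proof.
move=> loc; split; last by rewrite -addn1; apply: (@located_catr P q [:: i]).
by case: loc => s1 [s2 [-> <-]]; elim: s1.
Qed.

Section Logic.
Variable W : nat.
Implicit Types (c : cmd) (m : memory) (P : program) (s : state) (Q R : memory -> Prop).

Definition bounded m : Prop := forall a, m a <= W.

Definition runs P j s s' : Prop :=
  iter j (step P) s = s' /\ forall i, i <= j -> bounded (st_mem (iter i (step P) s)).

Lemma runs0 P s : bounded (st_mem s) -> runs P 0 s s.
Proof. by move=> bound; split=> // -[]. Qed.

Lemma runs_step P s i j s' : onth P (st_pc s) = Some i -> bounded (st_mem s) ->
  runs P j (exec i s) s' -> runs P j.+1 s s'.
Proof.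
move=> fetch bound [<- bounds]; have stepE : step P s = exec i s by rewrite /step fetch.
split=> [|[|l] le_l //]; rewrite iterSr stepE //; exact: bounds.
Qed.

Lemma runs_trans P j1 j2 s1 s2 s3 :
  runs P j1 s1 s2 -> runs P j2 s2 s3 -> runs P (j1 + j2) s1 s3.
Proof.
move=> [run1 bounds1] [run2 bounds2]; split; first by rewrite addnC iterD run1.
move=> i le_i; case: (leqP i j1) => [/bounds1//|lt_i].
by rewrite -(subnK (ltnW lt_i)) iterD run1; apply: bounds2; lia.
Qed.

Definition wp c m k Q : Prop :=
  bounded m -> forall P q, located P q (compile q c) ->
  exists j m', [/\ j <= k, bounded m', Q m' &
    runs P j (State q m) (State (q + code_size c) m')].

Lemma wp_weaken c m k k' Q Q' : wp c m k Q -> k <= k' ->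
  (forall m', Q m' -> Q' m') -> wp c m k' Q'.
Proof.
move=> wp_c le_k QQ' bound P q /(wp_c bound)[j [m' [le_j bound' Qm' run]]].
by exists j, m'; split=> //; [apply: leq_trans le_k | apply: QQ'].
Qed.

Lemma wp_skip m k Q : Q m -> wp CSkip m k Q.
Proof. by move=> Qm bound P q _; exists 0, m; rewrite addn0; split=> //; apply: runs0. Qed.

Lemma wp_instr c i m m' k Q : (forall q, compile q c = [:: i]) ->
  (forall q, exec i (State q m) = State q.+1 m') -> (bounded m -> bounded m') ->
  Q m' -> wp c m k.+1 Q.
Proof.
move=> codeE execE bound' Qm' bound P q; rewrite codeE => /located_cons[fetch _].
exists 1, m'; split=> //; first exact: bound'.
rewrite -(size_compile q) codeE addn1.
apply: (runs_step (s := State q m) fetch bound); rewrite execE.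
by apply: runs0; apply: bound'.
Qed.

Lemma bounded_upd m a x : bounded m -> x <= W -> bounded (upd m a x).
Proof. by move=> bound le_x b; rewrite /upd; case: eqP. Qed.

Definition immediate_le (x : operand) : bool := if x is Imm a then a <= W else true.

Lemma operand_val_le m x : bounded m -> immediate_le x -> operand_val m x <= W.
Proof. by case: x => [a|l] bound //= _; apply: bound. Qed.

Lemma wp_mov l x m k Q : immediate_le x ->
  Q (upd m (loc_addr m l) (operand_val m x)) -> wp (CMov l x) m k.+1 Q.
Proof.
move=> le_x; apply: (wp_instr (i := IMov l x)) => // bound.
by apply: bounded_upd => //; apply: operand_val_le.
Qed.

Lemma wp_add l x y m k Q : operand_val m x + operand_val m y <= W ->
  Q (upd m (loc_addr m l) (operand_val m x + operand_val m y)) ->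
  wp (CAdd l x y) m k.+1 Q.
Proof. by move=> le; apply: (wp_instr (i := IAdd l x y)) => // /bounded_upd; apply. Qed.

Lemma wp_sub l x y m k Q : immediate_le x ->
  Q (upd m (loc_addr m l) (operand_val m x - operand_val m y)) ->
  wp (CSub l x y) m k.+1 Q.
Proof.
move=> le_x; apply: (wp_instr (i := ISub l x y)) => // bound.
by apply: bounded_upd; rewrite // leq_subLR (leq_trans (operand_val_le bound le_x)) ?leq_addl.
Qed.

Lemma wp_seq c1 c2 m k1 k2 Q :
  wp c1 m k1 (fun m1 => wp c2 m1 k2 Q) -> wp (CSeq c1 c2) m (k1 + k2) Q.
Proof.
move=> wp1 bound P q /= code.
have [j1 [m1 [le1 bound1 wp2 run1]]] := wp1 bound P q (located_catl code).
have := located_catr code; rewrite size_compile => /(wp2 bound1).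
case=> j2 [m2 [le2 bound2 Qm2 run2]]; exists (j1 + j2), m2; split=> //.
  exact: leq_add.
by rewrite addnA; apply: runs_trans run1 run2.
Qed.

Lemma wp_call c1 c2 m k1 k Q R : wp c1 m k1 R -> k1 <= k ->
  (forall m1, R m1 -> wp c2 m1 (k - k1) Q) -> wp (CSeq c1 c2) m k Q.
Proof.
by move=> wp1 le_k wp2; rewrite -(subnKC le_k); apply: wp_seq; apply: wp_weaken wp1 _ wp2.
Qed.

Lemma wp_if x y c1 c2 m k Q :
  (operand_val m x <= operand_val m y -> wp c1 m k Q) ->
  (operand_val m y < operand_val m x -> wp c2 m k Q) ->
  wp (CIf x y c1 c2) m k.+2 Q.
Proof.
move=> wp1 wp2 bound P q /= /located_cons[fetch_if code].
have code2 := located_catl code; have := located_catr code; rewrite size_compile.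
rewrite !addSn => /located_cons[fetch_jmp code1].
have [guard|guard] := leqP (operand_val m x) (operand_val m y).
  have [j [m' [le_j bound' Qm' run]]] := wp1 guard bound P _ code1.
  exists j.+1, m'; split=> //; first by rewrite ltnS ltnW.
  apply: (runs_step (s := State q m) fetch_if bound); rewrite /= guard.
  suff <- : (q + code_size c2).+2 + code_size c1 = q + (code_size c1 + code_size c2).+2 by [].
  by lia.
have [j [m' [le_j bound' Qm' run]]] := wp2 guard bound P _ code2.
exists j.+2, m'; split=> //.
apply: (runs_step (s := State q m) fetch_if bound); rewrite /= leqNgt guard -addn1.
rewrite addSn in run; apply: runs_trans run _.
apply: (runs_step (s := State (q.+1 + code_size c2) m') fetch_jmp bound') => /=.
have -> : q + (code_size c1 + code_size c2).+2 = (q + code_size c2 + code_size c1).+2 by lia.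
exact: runs0.
Qed.

Lemma wp_while (I : nat -> memory -> Prop) x y c Q :
  (forall k m, I k m -> operand_val m y < operand_val m x -> 1 < k /\ Q m) ->
  (forall k m, I k m -> operand_val m x <= operand_val m y ->
     exists k1 k2, k1 + k2 + 2 <= k /\ wp c m k1 (I k2)) ->
  forall k m, I k m -> wp (CWhile x y c) m k Q.
Proof.
move=> exit body k m Im bound P q; rewrite [compile _ _]/= => code.
have [fetch_le /located_cons[fetch_exit]] := located_cons code.
rewrite -cats1 => code_body; have code_c := located_catl code_body.
have := located_catr code_body; rewrite size_compile => /located_cons[fetch_back _].
have [n le_n] := ubnP k; elim: n k m Im bound le_n => // n IHn k m Im bound le_n.
have [guard|guard] := leqP (operand_val m x) (operand_val m y); last first.
  have [k_gt1 Qm] := exit k m Im guard; exists 2, m; split=> //.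
  apply: (runs_step (s := State q m) fetch_le bound); rewrite /= leqNgt guard /=.
  apply: (runs_step (s := State q.+1 m) fetch_exit bound) => /=.
  by rewrite !addSn !addnS; apply: runs0.
have [k1 [k2 [le_k wp_c]]] := body k m Im guard.
have [j1 [m1 [le_j1 bound1 I1 run1]]] := wp_c bound P q.+2 code_c.
have [|j2 [m2 [le_j2 bound2 Qm2 run2]]] := IHn k2 m1 I1 bound1; first by lia.
exists (j1 + j2.+1).+1, m2; split=> //; first by lia.
apply: (runs_step (s := State q m) fetch_le bound); rewrite /= guard.
apply: runs_trans run1 _.
exact: (runs_step (s := State (q.+2 + code_size c) m1) fetch_back bound1).
Qed.

Lemma wp_for (J : nat -> memory -> Prop) x y c k N :
  (forall i m, i <= N -> J i m -> (operand_val m x <= operand_val m y) = (i < N)) ->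
  (forall i m, i < N -> J i m -> wp c m k (J i.+1)) ->
  forall m, J 0 m -> wp (CWhile x y c) m ((k + 2) * N + 2) (J N).
Proof.
move=> guard body m J0.
pose I k' m := exists2 i, i <= N /\ (k + 2) * (N - i) + 2 <= k' & J i m.
apply: (wp_while (I := I)) => [k' m' [i [le_i le_k'] Ji]|k' m' [i [le_i le_k'] Ji]|].
- rewrite ltnNge (guard i) // -leqNgt => le_N.
  by have <- : i = N by [lia]; split=> //; lia.
- rewrite (guard i) // => lt_i; exists k, ((k + 2) * (N - i.+1) + 2); split.
    by apply: leq_trans le_k'; rewrite (_ : N - i = (N - i.+1).+1) ?mulnS; lia.
  by apply: wp_weaken (body i m' lt_i Ji) (leqnn k) _ => m1 J1; exists i.+1.
by exists 0; rewrite // subn0.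
Qed.

Lemma wp_ram_computes c input k (R : nat -> Prop) :
  bounded (nth 0 input) -> wp c (nth 0 input) k (fun m => R (m 0)) ->
  exists2 out, R out & ram_computes (compile 0 c) input k W out.
Proof.
move=> bound /(_ bound (compile 0 c) 0)[]; first by exists [::], [::]; rewrite cats0.
move=> j [m [le_j _ Rm [run bounds]]]; exists (m 0) => //; exists j => //.
split; rewrite /start ?run //; first by rewrite /halted size_compile.
by move=> i a /bounds; apply.
Qed.

End Logic.

(** * The program *)

Arguments upd : simpl never.

Lemma upd_same m a x b : b = a -> upd m a x b = x.
Proof. by move=> ->; rewrite /upd eqxx. Qed.

Lemma upd_diff m a x b : b <> a -> upd m a x b = m b.
Proof. by move=> /eqP/negbTE nab; rewrite /upd nab. Qed.

(* Resolves memory reads, innermost updates first, by comparing addresses. *)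
Local Ltac read := repeat first
  [ match goal with |- context [upd ?m ?a ?x ?b] =>
      lazymatch b with context [upd] => fail | _ => idtac end;
      lazymatch a with context [upd] => fail | _ => idtac end;
      first [ rewrite (@upd_same m a x b); [|reflexivity]
            | rewrite (@upd_diff m a x b); [|discriminate]
            | rewrite (@upd_diff m a x b); [|clear; lia]
            | rewrite (@upd_diff m a x b); [|lia]
            | rewrite (@upd_same m a x b); [|lia] ] end
  | match goal with H : ?m ?a = _ |- context [?m ?a] =>
      match type of m with memory => rewrite H end end ].

Local Ltac simp_mem := rewrite /= ?addn0; read; rewrite ?addn0.

Local Ltac assign :=
  try apply: (wp_seq (k1 := 1)); first [apply: wp_mov | apply: wp_add | apply: wp_sub];
  [simp_mem; try lia | simp_mem].

Local Ltac branch := apply: wp_if; simp_mem.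

Local Notation "c1 ;; c2" := (CSeq c1 c2) (at level 60, right associativity).
Local Notation "'reg' i" := (Cell (Dir i)) (at level 10).
Local Notation "'deref' i" := (Cell (Ind i)) (at level 10).

Local Notation rOut := 0 (only parsing).
Local Notation rTarget := 1 (only parsing).
Local Notation rSpan := 2 (only parsing).
Local Notation rK := 3 (only parsing).
Local Notation rDegs := 4 (only parsing).
Local Notation rSums := 5 (only parsing).
Local Notation rHead := 6 (only parsing).
Local Notation rTail := 7 (only parsing).
Local Notation rLimit := 8 (only parsing).
Local Notation rIndex := 9 (only parsing).
Local Notation rVertex := 10 (only parsing).
Local Notation rNbr := 11 (only parsing).
Local Notation rAddr := 12 (only parsing).
Local Notation rLeft := 13 (only parsing).
Local Notation rVal := 14 (only parsing).
Local Notation rMax := 15 (only parsing).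

Local Notation input_at n a := (2 * n + 16 + a) (only parsing).
Local Notation deg_at n v := (4 * n + 17 + v) (only parsing).
Local Notation sum_at n v := (6 * n + 17 + v) (only parsing).
Local Notation queue_at n j := (8 * n + 17 + j) (only parsing).

(* Only cells 0 and 1 are free at first: the edges, followed by k, are
   moved to [input_at n 2 .. input_at n (2 * n)], so that the first 16 cells can
   serve as registers. The number n itself is lost, and only 2n is available
   afterwards. *)
Definition prog_relocate : cmd :=
  CAdd (Dir rOut) (reg rOut) (reg rOut) ;;
  CMov (Ind rOut) (reg rTarget) ;;
  CAdd (Dir rTarget) (reg rOut) (reg rOut) ;;
  CAdd (Dir rTarget) (reg rTarget) (Imm 16) ;;
  CWhile (Imm 2) (reg rOut)
    (CMov (Ind rTarget) (deref rOut) ;;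
     CSub (Dir rOut) (reg rOut) (Imm 1) ;;
     CSub (Dir rTarget) (reg rTarget) (Imm 1)).

(* [rLeft] holds twice the number of vertices left. *)
Definition prog_setup : cmd :=
  CSub (Dir rSpan) (reg rTarget) (Imm 17) ;;
  CAdd (Dir rDegs) (reg rTarget) (reg rSpan) ;;
  CAdd (Dir rSums) (reg rDegs) (reg rSpan) ;;
  CAdd (Dir rHead) (reg rSums) (reg rSpan) ;;
  CMov (Dir rTail) (reg rHead) ;;
  CMov (Dir rLeft) (reg rSpan) ;;
  CAdd (Dir rIndex) (reg rTarget) (Imm 1) ;;
  CSub (Dir rLimit) (reg rDegs) (Imm 1) ;;
  CMov (Dir rK) (deref rLimit) ;;
  CSub (Dir rLimit) (reg rLimit) (Imm 1).

Definition prog_edge : cmd :=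
  CMov (Dir rVertex) (deref rIndex) ;;
  CAdd (Dir rIndex) (reg rIndex) (Imm 1) ;;
  CMov (Dir rNbr) (deref rIndex) ;;
  CAdd (Dir rIndex) (reg rIndex) (Imm 1) ;;
  CAdd (Dir rAddr) (reg rDegs) (reg rVertex) ;;
  CAdd (Ind rAddr) (deref rAddr) (Imm 1) ;;
  CAdd (Dir rAddr) (reg rDegs) (reg rNbr) ;;
  CAdd (Ind rAddr) (deref rAddr) (Imm 1) ;;
  CAdd (Dir rAddr) (reg rSums) (reg rVertex) ;;
  CAdd (Ind rAddr) (deref rAddr) (reg rNbr) ;;
  CAdd (Dir rAddr) (reg rSums) (reg rNbr) ;;
  CAdd (Ind rAddr) (deref rAddr) (reg rVertex).

Definition prog_edges : cmd := CWhile (reg rIndex) (reg rLimit) prog_edge.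

Definition prog_scan (body : cmd) : cmd :=
  CMov (Dir rIndex) (Imm 0) ;;
  CSub (Dir rLimit) (reg rSpan) (Imm 1) ;;
  CWhile (reg rIndex) (reg rLimit)
    (CAdd (Dir rAddr) (reg rDegs) (reg rIndex) ;;
     CMov (Dir rVal) (deref rAddr) ;;
     body ;;
     CAdd (Dir rIndex) (reg rIndex) (Imm 1)).

Definition push_if_one (x : nat) : cmd :=
  CIf (Imm 1) (reg rVal)
    (CIf (reg rVal) (Imm 1)
       (CMov (Ind rTail) (reg x) ;; CAdd (Dir rTail) (reg rTail) (Imm 1))
       CSkip)
    CSkip.

Definition prog_leaves : cmd := CMov (Dir rOut) (Imm 0) ;; prog_scan (push_if_one rIndex).

Definition prog_max : cmd :=
  CMov (Dir rMax) (Imm 0) ;;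
  prog_scan (CIf (reg rMax) (reg rVal) (CMov (Dir rMax) (reg rVal)) CSkip).

Definition prog_unlink : cmd :=
  CMov (Dir rVertex) (deref rHead) ;;
  CAdd (Dir rHead) (reg rHead) (Imm 1) ;;
  CAdd (Dir rAddr) (reg rDegs) (reg rVertex) ;;
  CMov (Ind rAddr) (Imm 0) ;;
  CAdd (Dir rAddr) (reg rSums) (reg rVertex) ;;
  CMov (Dir rNbr) (deref rAddr) ;;
  CMov (Ind rAddr) (Imm 0) ;;
  CAdd (Dir rAddr) (reg rSums) (reg rNbr) ;;
  CSub (Ind rAddr) (deref rAddr) (reg rVertex) ;;
  CAdd (Dir rAddr) (reg rDegs) (reg rNbr) ;;
  CSub (Ind rAddr) (deref rAddr) (Imm 1) ;;
  CMov (Dir rVal) (deref rAddr) ;;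
  CSub (Dir rLeft) (reg rLeft) (Imm 2) ;;
  CAdd (Dir rOut) (reg rOut) (Imm 1).

Definition prog_remove : cmd := prog_unlink ;; push_if_one rNbr.

Definition prog_round : cmd :=
  CSub (Dir rLimit) (reg rTail) (Imm 1) ;;
  CWhile (reg rHead) (reg rLimit) prog_remove.

(* The guard holds if at most two vertices are left; then every k >= 2 gives the same
   value as 2. *)
Definition prog_shrink : cmd :=
  CIf (reg rLeft) (Imm 5)
    (CMov (Dir rK) (Imm 2))
    (prog_round ;; CSub (Dir rK) (reg rK) (Imm 2)).

Definition prog_rounds : cmd := CWhile (Imm 3) (reg rK) prog_shrink.

Definition prog_answer : cmd :=
  prog_max ;;
  CIf (reg rK) (Imm 1) (CIf (Imm 2) (reg rMax) (CMov (Dir rMax) (Imm 1)) CSkip) CSkip ;;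
  CAdd (Dir rOut) (reg rOut) (reg rMax).

Definition prog_input : cmd := prog_relocate ;; prog_setup ;; prog_edges ;; prog_leaves.

Definition prog_cc : cmd := prog_input ;; prog_rounds ;; prog_answer.

Section Layout.
Variable n : nat.
Implicit Types (m : memory) (deg sum : nat -> nat) (qs : seq nat).

Definition regs m : Prop :=
  [/\ m rSpan = 2 * n, m rDegs = 4 * n + 17 & m rSums = 6 * n + 17].

Definition tables m deg sum : Prop := forall v, v < 2 * n ->
  m (deg_at n v) = deg v /\ m (sum_at n v) = sum v.

Definition queue m (h : nat) qs : Prop :=
  [/\ m rHead = queue_at n h, m rTail = queue_at n (h + size qs) &
      forall j, j < size qs -> m (queue_at n (h + j)) = nth 0 qs j].

Definition layout m deg sum h qs : Prop :=
  [/\ regs m, tables m deg sum & queue m h qs].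

Definition layout_regs : seq nat := [:: rSpan; rDegs; rSums; rHead; rTail].

Lemma eq_layout m m' deg sum h qs :
  (forall a, (a \in layout_regs) || (deg_at n 0 <= a) -> m' a = m a) ->
  layout m deg sum h qs -> layout m' deg sum h qs.
Proof.
move=> same [[span degs sums] tab [head tail cells]]; split.
- by split; rewrite same.
- by move=> v lt_v; rewrite !same; [apply: tab | lia | lia].
split; rewrite ?same // => j lt_j.
by rewrite same; [apply: cells | rewrite !inE; lia].
Qed.

Lemma eq_layout_tables m deg deg' sum sum' h qs : deg =1 deg' -> sum =1 sum' ->
  layout m deg sum h qs -> layout m deg' sum' h qs.
Proof.
by move=> eq_deg eq_sum [rm tab qm]; split=> // v lt_v; rewrite -eq_deg -eq_sum; apply: tab.
Qed.

End Layout.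

Section InputPhase.
Variables (n W : nat).
Hypothesis W_large : 12 * n + 40 <= W.
Implicit Types (m : memory).

Lemma wp_setup m : m rTarget = input_at n 1 ->
  (forall a, input_at n (2 * n) < a -> m a = 0) ->
  wp W prog_setup m 10 (fun m' =>
    [/\ layout n m' (fun=> 0) (fun=> 0) 0 [::],
        m' rK = m (input_at n (2 * n)) /\ m' rLeft = 2 * n,
        m' rIndex = input_at n 2 /\ m' rLimit = input_at n (2 * n) - 1 &
        forall a, input_at n 2 <= a -> m' a = m a]).
Proof.
move=> target zero; rewrite /prog_setup; do 8 assign.
have limit : 2 * n + 16 + 1 + (2 * n + 16 + 1 - 17) - 1 = input_at n (2 * n) by lia.
rewrite limit; do 2 assign.
split; [| by split; read; lia | by split; read; lia | by move=> a le_a; read].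
split; first by split; read; lia.
  by move=> v lt_v; split; read; apply: zero; lia.
by split=> //; read; rewrite ?addn0; lia.
Qed.

Hypothesis n_gt0 : 0 < n.

Lemma wp_relocate m : m rOut = n -> (forall a, 2 * n <= a -> m a = 0) ->
  wp W prog_relocate m (10 * n + 1) (fun m' =>
    [/\ m' rTarget = input_at n 1,
        forall a, 2 <= a < 2 * n -> m' (input_at n a) = m a,
        m' (input_at n (2 * n)) = m 1 &
        forall a, input_at n (2 * n) < a -> m' a = 0]).
Proof.
move=> m0 zero; rewrite /prog_relocate.
pose g a := if a < 2 * n then m a else m 1.
pose J i m' := [/\ m' rOut = 2 * n - i, m' rTarget = input_at n (2 * n - i),
  forall a, 2 <= a <= 2 * n - i -> m' a = g a,
  forall a, 2 * n - i < a <= 2 * n -> m' (input_at n a) = g a &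
  forall a, input_at n (2 * n) < a -> m' a = 0].
have -> : 10 * n + 1 = 4 + ((3 + 2) * (2 * n - 1) + 2) by lia.
do 4 assign.
apply: wp_weaken (wp_for (J := J) (k := 3) _ _ _) (leqnn _) _ => [i m' le_i|i m' lt_i||m'].
- by case=> out _ _ _ _; rewrite /= out; lia.
- case=> out target low high above.
  have last_low : m' (2 * n - i) = g (2 * n - i) by apply: low; lia.
  do 3 assign; split; try by read; lia.
  + by move=> a le_a; read; apply: low; lia.
  + move=> a le_a; case: (eqVneq a (2 * n - i)) => [->|ne]; read => //.
    by apply: high; lia.
  + by move=> a lt_a; read; apply: above.
- split; try by read; lia.
  + by move=> a le_a; rewrite /g; case: ltnP => lt_a; read.
  + by move=> a lt_a; read; apply: zero; lia.
case=> out target low high above; split=> //.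
- by rewrite target; lia.
- by move=> a /andP[lo hi]; rewrite high /g ?hi //; lia.
- by rewrite high /g ?ltnn //; lia.
Qed.

End InputPhase.

Definition incident (F : nat -> nat) (ps : seq (nat * nat)) (v : nat) :=
  \sum_(p <- ps) ((if p.1 == v then F p.2 else 0) + (if p.2 == v then F p.1 else 0)).

Lemma incident_rcons F ps x y : x != y -> incident F (rcons ps (x, y)) =1
  upd (upd (incident F ps) x (incident F ps x + F y)) y (incident F ps y + F x).
Proof.
move=> nxy v; rewrite /upd /incident -cats1 big_cat big_seq1 /= ![_ == v]eq_sym.
case: (eqVneq v y) => [->|_]; first by rewrite eq_sym (negbTE nxy).
by case: (eqVneq v x) => [->|_]; rewrite ?addn0.
Qed.

Lemma incident_le F (ps : seq (nat * nat)) v c : {in ps, forall p, F p.1 <= c /\ F p.2 <= c} ->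
  incident F ps v <= 2 * c * size ps.
Proof.
move=> F_le; rewrite /incident -sum1_size big_distrr /= big_seq [leqRHS]big_seq.
apply: leq_sum => p /F_le[F1 F2]; rewrite muln1 mulSn mul1n.
by apply: leq_add; case: ifP.
Qed.

Section EdgePhase.
Variables (n W : nat).
Hypothesis W_large : 12 * n + 40 <= W.
Implicit Types (m : memory) (deg sum : nat -> nat) (ps : seq (nat * nat)) (qs : seq nat).

Lemma wp_edge x y deg sum h qs m : layout n m deg sum h qs ->
  m (m rIndex) = x -> m (m rIndex + 1) = y -> x < n -> y < n -> x != y ->
  16 <= m rIndex < deg_at n 0 -> deg x < W -> deg y < W ->
  sum x + n <= W -> sum y + n <= W ->
  wp W prog_edge m 12 (fun m' =>
    [/\ layout n m' (upd (upd deg x (deg x + 1)) y (deg y + 1))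
                    (upd (upd sum x (sum x + y)) y (sum y + x)) h qs,
        m' rIndex = m rIndex + 2 &
        forall a, a < deg_at n 0 -> a \notin [:: rIndex; rVertex; rNbr; rAddr] ->
          m' a = m a]).
Proof.
move=> [[span degs sums] tab [head tail cells]] m_x m_y x_lt y_lt nxy le_index *.
have [deg_x sum_x] := tab x (ltac:(lia)); have [deg_y sum_y] := tab y (ltac:(lia)).
rewrite /prog_edge; do 12 assign; split.
- split; first by split; read.
    move=> v lt_v; have [deg_v sum_v] := tab v lt_v.
    by case: (eqVneq v x) => [->|nvx]; [|case: (eqVneq v y) => [->|nvy]]; read.
  by split=> [||j lt_j]; read => //; apply: cells.
- by read; lia.
by move=> a lt_a; rewrite !inE => notin; read.
Qed.

Hypothesis W_square : 2 * n * n + n <= W.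

Lemma incident_le_word ps v : size ps <= n ->
  {in ps, forall p, [/\ p.1 < n, p.2 < n & p.1 != p.2]} ->
  incident (fun=> 1) ps v < W /\ incident id ps v + n <= W.
Proof.
move=> ps_size ps_ok; split.
  by apply: leq_ltn_trans (incident_le (c := 1) v _) _ => //; lia.
apply: leq_trans W_square; rewrite leq_add2r.
apply: leq_trans (_ : 2 * n * size ps <= _); last by rewrite leq_mul2l ps_size orbT.
by apply: incident_le => p /ps_ok[p1 p2 _]; split; apply: ltnW.
Qed.

Section AllEdges.
Variable ps : seq (nat * nat).
Hypotheses (ps_size : size ps < n)
  (ps_ok : {in ps, forall p, [/\ p.1 < n, p.2 < n & p.1 != p.2]}).

Definition edges_input m : Prop := forall i, i < size ps ->
  m (input_at n (2 + 2 * i)) = (nth (0, 0) ps i).1 /\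
  m (input_at n (3 + 2 * i)) = (nth (0, 0) ps i).2.

Definition edges_inv m0 i m : Prop :=
  [/\ layout n m (incident (fun=> 1) (take i ps)) (incident id (take i ps)) 0 [::],
      m rIndex = input_at n (2 + 2 * i) &
      forall a, a < deg_at n 0 -> a \notin [:: rIndex; rVertex; rNbr; rAddr] -> m a = m0 a].

Lemma wp_edges_step m0 i m : edges_input m0 -> i < size ps -> edges_inv m0 i m ->
  wp W prog_edge m 12 (edges_inv m0 i.+1).
Proof.
move=> input lt_i [layout_m index same].
have [x_lt y_lt nxy] := ps_ok (mem_nth (0, 0) lt_i); have [m_x m_y] := input i lt_i.
have words v : incident (fun=> 1) (take i ps) v < W /\ incident id (take i ps) v + n <= W.
  apply: incident_le_word => [|p /mem_take/ps_ok//].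
  by rewrite size_take lt_i; lia.
have [deg_x sum_x] := words (nth (0, 0) ps i).1.
have [deg_y sum_y] := words (nth (0, 0) ps i).2.
have input_m a : input_at n 2 <= a < deg_at n 0 -> m a = m0 a.
  by move=> a_in; apply: same; rewrite ?inE; lia.
apply: wp_weaken (wp_edge layout_m _ _ x_lt y_lt nxy _ deg_x deg_y sum_x sum_y) _ _.
- by rewrite index input_m //; lia.
- rewrite index -addnA (_ : 2 + 2 * i + 1 = 3 + 2 * i); last by lia.
  by rewrite input_m //; lia.
- by rewrite index; lia.
- by [].
move=> m' [layout' index' same']; split; last 2 first.
- by rewrite index' index; lia.
- by move=> a lt_a a_notin; rewrite same' // same.
by apply: eq_layout_tables layout' => v;
  rewrite (take_nth (0, 0)) // [nth _ _ _]surjective_pairing incident_rcons.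
Qed.

Lemma wp_edges m : layout n m (fun=> 0) (fun=> 0) 0 [::] -> edges_input m ->
  m rIndex = input_at n 2 -> m rLimit = input_at n (2 + 2 * size ps) - 1 ->
  wp W prog_edges m (14 * n) (fun m' =>
    layout n m' (incident (fun=> 1) ps) (incident id ps) 0 [::] /\
    {in [:: rK; rLeft], m' =1 m}).
Proof.
move=> layout_m input index limit.
apply: wp_weaken (wp_for (J := edges_inv m) (k := 12) (N := size ps) _ _ _) _ _.
- move=> i m' _ [_ index' same].
  have limit' : m' rLimit = m rLimit by apply: same => //; lia.
  by rewrite /= index' limit' limit; lia.
- by move=> i m'; apply: wp_edges_step.
- split; rewrite ?muln0 ?addn0 //.
  by apply: eq_layout_tables layout_m => v; rewrite take0 /incident big_nil.
- by lia.
move=> m' [layout' _ same]; rewrite take_size in layout'; split=> // a.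
by rewrite !inE => a_in; apply: same; rewrite ?inE; lia.
Qed.

End AllEdges.
End EdgePhase.

Section ScanPhase.
Variables (n W : nat).
Implicit Types (m : memory) (deg sum : nat -> nat) (qs : seq nat).

Lemma wp_push_if_one x deg sum h qs m :
  layout n m deg sum h qs -> queue_at n (h + size qs) < W ->
  wp W (push_if_one x) m 6 (fun m' =>
    layout n m' deg sum h (if m rVal == 1 then rcons qs (m x) else qs) /\
    forall a, a < queue_at n 0 -> a != rTail -> m' a = m a).
Proof.
move=> layout_m qs_le; have [[span degs sums] tab [head tail cells]] := layout_m.
rewrite /push_if_one; branch=> val_ge1; last first.
  by apply: wp_skip; split=> //; rewrite (_ : m _ == 1 = false) //; lia.
branch=> val_le1; last first.
  by apply: wp_skip; split=> //; rewrite (_ : m _ == 1 = false) //; lia.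
do 2 assign; rewrite (_ : m _ == 1); last by lia.
split=> [|a lt_a ne_tail]; last by read.
split; first by split; read.
  by move=> v lt_v; have [deg_v sum_v] := tab v lt_v; read.
split=> [||j]; [by read | by read; rewrite size_rcons; lia |].
rewrite size_rcons ltnS nth_rcons; case: ltngtP => // [lt_j|->] _; read => //.
exact: cells.
Qed.

Hypotheses (n_gt0 : 0 < n) (W_large : 12 * n + 40 <= W).

Definition scan_regs : seq nat := [:: rLimit; rIndex; rVal; rAddr].

Lemma wp_scan (J : nat -> memory -> Prop) body k deg sum h (qs : nat -> seq nat) m :
  (forall i m1 m2, {in [predC scan_regs], m2 =1 m1} -> J i m1 -> J i m2) ->
  (forall i m1, J i m1 -> layout n m1 deg sum h (qs i)) ->
  (forall i m1, i < 2 * n -> J i m1 -> m1 rIndex = i -> m1 rVal = deg i ->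
     wp W body m1 k (fun m2 => J i.+1 m2 /\ {in [:: rIndex; rLimit], m2 =1 m1})) ->
  J 0 m -> wp W (prog_scan body) m (2 * n * (k + 5) + 4) (J (2 * n)).
Proof.
move=> stable layoutJ body_spec J0.
pose J' i m' := [/\ J i m', m' rIndex = i & m' rLimit = 2 * n - 1].
have -> : 2 * n * (k + 5) + 4 = 2 + ((2 + (k + 1) + 2) * (2 * n) + 2) by lia.
have [[span _ _] _ _] := layoutJ _ _ J0; rewrite /prog_scan; do 2 assign.
apply: wp_weaken (wp_for (J := J') _ _ _) (leqnn _) _ => [i m1 le_i|i m1 lt_i||m1 []//].
- by case=> _ index limit; rewrite /= index limit; lia.
- case=> J1 index limit; have [[_ degs _] tab _] := layoutJ _ _ J1.
  have [deg_i _] := tab i lt_i; do 2 assign; apply: wp_seq.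
  apply: wp_weaken (body_spec i _ lt_i _ _ _) (leqnn _) _; try by read.
    by apply: stable J1 => a; rewrite !inE => notin; read.
  move=> m2 [J2 same].
  have index2 : m2 rIndex = i by rewrite same //; read.
  have limit2 : m2 rLimit = 2 * n - 1 by rewrite same //; read.
  assign; split; [|by read; lia | by read].
  by apply: stable J2 => a; rewrite !inE => notin; read.
by split; read => //; apply: stable J0 => a; rewrite !inE => notin; read.
Qed.

Lemma wp_leaves deg sum m : layout n m deg sum 0 [::] ->
  wp W prog_leaves m (22 * n + 5) (fun m' =>
    [/\ layout n m' deg sum 0 [seq v <- iota 0 (2 * n) | deg v == 1], m' rOut = 0 &
        {in [:: rK; rLeft], m' =1 m}]).
Proof.
move=> layout_m; rewrite /prog_leaves.
have -> : 22 * n + 5 = 1 + (2 * n * (6 + 5) + 4) by lia.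
assign; pose qs i := [seq v <- iota 0 i | deg v == 1].
have qsS i : qs i.+1 = if deg i == 1 then rcons (qs i) i else qs i.
  by rewrite /qs -[i.+1]addn1 iotaD filter_cat /= add0n; case: eqP; rewrite ?cats0 ?cats1.
pose J i m' := [/\ layout n m' deg sum 0 (qs i), m' rOut = 0 & {in [:: rK; rLeft], m' =1 m}].
apply: (wp_scan (J := J) (deg := deg) (sum := sum) (h := 0) (qs := qs)).
- move=> i m1 m2 same [layout1 out1 same1]; split; last 2 first.
  + by rewrite same.
  + by move=> a a_in; rewrite -same1 //; apply: same; move: a_in; rewrite !inE; lia.
  by apply: eq_layout layout1 => a; rewrite !inE => a_in; apply: same; rewrite !inE; lia.
- by move=> i m1 [].
- move=> i m1 lt_i [layout1 out1 same1] index val.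
  have size_qs : size (qs i) <= i by rewrite size_filter -[leqRHS](size_iota 0) count_size.
  apply: wp_weaken (wp_push_if_one layout1 _) (leqnn _) _; first by lia.
  move=> m2 [layout2 same2]; rewrite val index -qsS in layout2.
  split; last by move=> a; rewrite !inE => a_in; apply: same2; lia.
  split=> //; first by rewrite same2 //; lia.
  by move=> a a_in; rewrite -same1 //; move: a_in; rewrite !inE => a_in; apply: same2; lia.
split; read => //; last by move=> a; rewrite !inE => a_in; read.
by apply: eq_layout layout_m => a; rewrite !inE => a_in; read.
Qed.

Lemma wp_max deg sum h qs m : layout n m deg sum h qs ->
  wp W prog_max m (16 * n + 5) (fun m' =>
    m' rMax = \max_(v < 2 * n) deg v /\ {in [:: rOut; rK], m' =1 m}).
Proof.
move=> layout_m; rewrite /prog_max.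
have -> : 16 * n + 5 = 1 + (2 * n * (3 + 5) + 4) by lia.
assign; pose J i m' := [/\ layout n m' deg sum h qs, m' rMax = \max_(v < i) deg v &
  {in [:: rOut; rK], m' =1 m}].
apply: wp_weaken (wp_scan (J := J) (deg := deg) (sum := sum) (h := h) (qs := fun=> qs)
  _ _ _ _) (leqnn _) _ => [i m1 m2 same|i m1 []//|i m1 lt_i||m' []//].
- case=> layout1 max1 same1; split; last 2 first.
  + by rewrite same.
  + by move=> a a_in; rewrite -same1 //; apply: same; move: a_in; rewrite !inE; lia.
  by apply: eq_layout layout1 => a; rewrite !inE => a_in; apply: same; rewrite !inE; lia.
- case=> layout1 max1 same1 index val; branch=> [le_max|lt_max].
    assign; split; last by move=> a; rewrite !inE => a_in; read.
    split.
    + by apply: eq_layout layout1 => a; rewrite !inE => a_in; read.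
    + by read; rewrite big_ord_recr /=; apply/esym/maxn_idPr.
    by move=> a a_in; rewrite -same1 //; move: a_in; rewrite !inE => a_in; read.
  apply: wp_skip; split=> //; split=> //.
  by rewrite max1 big_ord_recr /=; apply/esym/maxn_idPl/ltnW.
split; read; rewrite ?big_ord0 //; last by move=> a; rewrite !inE => a_in; read.
by apply: eq_layout layout_m => a; rewrite !inE => a_in; read.
Qed.

End ScanPhase.

Section GraphTables.
Variables (n : nat) (e : rel 'I_n).
Hypothesis forest_e : forest e.
Implicit Types (A B : {set 'I_n}) (F : nat -> nat).

(* [F] is [fun=> 1] for the degrees and [id] for the sums of neighbours. *)
Definition nbr_table A F (v : nat) : nat :=
  if (insub v : option 'I_n) is Some x then
    if x \in A then \sum_(y in nbrs e A x) F y else 0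
  else 0.

Lemma nbr_tableE A F (x : 'I_n) :
  nbr_table A F x = if x \in A then \sum_(y in nbrs e A x) F y else 0.
Proof. by rewrite /nbr_table valK. Qed.

Lemma nbr_table_large A F v : n <= v -> nbr_table A F v = 0.
Proof. by move=> le_v; rewrite /nbr_table insubF // ltnNge le_v. Qed.

Lemma deg_tableE A (x : 'I_n) : x \in A -> nbr_table A (fun=> 1) x = #|nbrs e A x|.
Proof. by move=> xA; rewrite nbr_tableE xA sum1_card. Qed.

Lemma nbr_table_single B F (l u : 'I_n) : l \in B -> nbrs e B l = [set u] ->
  nbr_table B F l = F u.
Proof. by move=> lB nbr_l; rewrite nbr_tableE lB nbr_l big_set1. Qed.

Lemma nbr_table_remove B F (l u : 'I_n) : l \in B -> u \in B -> u != l ->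
  nbrs e B l = [set u] ->
  nbr_table (B :\ l) F =1 upd (upd (nbr_table B F) l 0) u (nbr_table B F u - F l).
Proof.
move=> lB uB nul nbr_l v; case: (ltnP v n) => [lt_v|le_v]; last first.
  have [lt_l lt_u] := (ltn_ord l, ltn_ord u).
  by rewrite !upd_diff ?nbr_table_large //; lia.
rewrite -[v]/(val (Ordinal lt_v)); move: (Ordinal lt_v) => {v lt_v}x.
rewrite /upd !val_eqE (nbr_tableE (B :\ l)) in_setD1; case: (eqVneq x u) => [->|nxu].
  rewrite nul uB /= nbr_tableE uB nbrs_D1 (big_setD1 l (A := nbrs e B u)) ?addKn //=.
  rewrite inE lB (forest_sym forest_e).
  by have := set11 u; rewrite -nbr_l inE => /andP[].
case: (eqVneq x l) => //= _; rewrite nbr_tableE; case: (boolP (x \in B)) => // xB.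
by rewrite (nbrs_remove forest_e nbr_l xB nxu).
Qed.

Lemma max_deg_table A : \max_(v < 2 * n) nbr_table A (fun=> 1) v = maxdeg e A.
Proof.
apply/eqP; rewrite eqn_leq; apply/andP; split; apply/bigmax_leqP.
  move=> v _; case: (ltnP v n) => [lt_v|/nbr_table_large-> //].
  rewrite -[X in nbr_table _ _ X]/(val (Ordinal lt_v)) nbr_tableE.
  by case: ifP => // vA; rewrite sum1_card; apply: leq_bigmax_cond.
move=> x xA; have lt_x : x < 2 * n by have := ltn_ord x; lia.
rewrite -deg_tableE //; exact: (leq_bigmax (Ordinal lt_x)).
Qed.

End GraphTables.

Lemma incident_nbr_table n (e : rel 'I_n) (es : seq ('I_n * 'I_n)) F :
  is_tree e -> edge_list e es ->
  incident F [seq (val p.1, val p.2) | p <- es] =1 nbr_table e setT F.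
Proof.
move=> tree_e edges_es v.
pose dart_val (p : 'I_n * 'I_n) := if p.1 == v :> nat then F p.2 else 0.
transitivity (\sum_(p <- es ++ [seq (p.2, p.1) | p <- es]) dart_val p).
  by rewrite /incident big_map big_split big_cat big_map.
rewrite (perm_big _ (edge_list_darts tree_e edges_es)) big_enum /= -big_mkcondr /=.
rewrite (eq_bigl (fun p : 'I_n * 'I_n => (p.1 == v :> nat) && e p.1 p.2)); last first.
  by move=> p; rewrite inE andbC.
rewrite -(pair_big_dep (fun x : 'I_n => x == v :> nat) (fun x y => e x y) (fun _ y => F y)) /=.
case: (ltnP v n) => [lt_v|le_v]; last first.
  rewrite nbr_table_large // big_pred0 // => x; have := ltn_ord x; lia.
rewrite -[v]/(val (Ordinal lt_v)) nbr_tableE inE (big_pred1 (Ordinal lt_v)) //.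
by apply: eq_bigl => y; rewrite !inE.
Qed.

Section Stores.
Variables (n : nat) (e : rel 'I_n).
Implicit Types (m : memory) (A : {set 'I_n}).

Definition stores m A (qs : seq 'I_n) : Prop :=
  [/\ layout n m (nbr_table e A (fun=> 1)) (nbr_table e A id) (m rOut) (map val qs),
      m rOut + #|A| = n & m rLeft = 2 * #|A|].

Lemma eq_stores m m' A qs :
  (forall a, (a \in [:: rOut, rLeft & layout_regs]) || (deg_at n 0 <= a) -> m' a = m a) ->
  stores m A qs -> stores m' A qs.
Proof.
move=> same [layout_m out left]; split; rewrite ?same //.
by apply: eq_layout layout_m => a; rewrite !inE => a_in; apply: same; rewrite !inE; lia.
Qed.

End Stores.

Section Removal.
Variables (n W : nat) (e : rel 'I_n).
Hypotheses (W_large : 12 * n + 40 <= W) (forest_e : forest e).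
Implicit Types (m : memory) (deg sum : nat -> nat) (A B : {set 'I_n}).

Lemma wp_unlink l u deg sum h qs m : layout n m deg sum h (l :: qs) ->
  sum l = u -> l < n -> u < n -> u != l -> h <= n -> m rOut <= n ->
  wp W prog_unlink m 14 (fun m' =>
    [/\ layout n m' (upd (upd deg l 0) u (deg u - 1)) (upd (upd sum l 0) u (sum u - l))
          h.+1 qs,
        m' rVal = deg u - 1 /\ m' rNbr = u, m' rOut = (m rOut).+1, m' rLeft = m rLeft - 2 &
        {in [:: rK; rLimit], m' =1 m}]).
Proof.
move=> [[span degs sums] tab [head tail cells]] sum_l l_lt u_lt nul h_le out_le.
have [_ sum_at_l] := tab l (ltac:(lia)); have [deg_u sum_u] := tab u (ltac:(lia)).
have head_l : m (8 * n + 17 + h) = l by have := cells 0 isT; rewrite addn0.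
rewrite sum_l in sum_at_l; rewrite /= in tail cells.
rewrite /prog_unlink; do 14 assign.
split; [split|by split; read|by read; rewrite addn1|by read|].
- by split; read.
- move=> v lt_v; have [deg_v sum_v] := tab v lt_v.
  by case: (eqVneq v u) => [->|nvu]; [|case: (eqVneq v l) => [->|nvl]]; read.
- split; read; rewrite ?addSnnS //; first by lia.
  by move=> j lt_j; read; have := cells j.+1 lt_j; rewrite addSnnS.
by move=> a; rewrite !inE => a_in; read.
Qed.

Lemma wp_remove l u deg sum h qs m : layout n m deg sum h (l :: qs) ->
  sum l = u -> l < n -> u < n -> u != l -> h <= n -> m rOut <= n -> size qs <= 2 * n ->
  wp W prog_remove m 20 (fun m' =>
    [/\ layout n m' (upd (upd deg l 0) u (deg u - 1)) (upd (upd sum l 0) u (sum u - l))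
          h.+1 (if deg u - 1 == 1 then rcons qs u else qs),
        m' rOut = (m rOut).+1, m' rLeft = m rLeft - 2 & {in [:: rK; rLimit], m' =1 m}]).
Proof.
move=> layout_m sum_l l_lt u_lt nul h_le out_le qs_le.
apply: wp_call (wp_unlink layout_m sum_l l_lt u_lt nul h_le out_le) _ _ => // m1.
case=> layout1 [val nbr] out left same.
apply: wp_weaken (wp_push_if_one layout1 _) _ _ => //; first by lia.
move=> m2 [layout2 same2]; rewrite val nbr in layout2; split=> //.
- by rewrite same2 ?out //; lia.
- by rewrite same2 ?left //; lia.
by move=> a a_in; rewrite -same //; move: a_in; rewrite !inE => a_in; apply: same2; lia.
Qed.

Lemma wp_remove_leaf m B (l u : 'I_n) qs : stores e m B (l :: qs) -> size qs <= 2 * n ->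
  l \in B -> u \in B -> u != l -> nbrs e B l = [set u] ->
  wp W prog_remove m 20 (fun m' =>
    [/\ stores e m' (B :\ l) (if #|nbrs e (B :\ l) u| == 1 then rcons qs u else qs),
        m' rOut = (m rOut).+1 & {in [:: rK; rLimit], m' =1 m}]).
Proof.
move=> [layout_m out left] qs_le lB uB nul nbr_l.
have B_card : #|B| = #|B :\ l|.+1 by rewrite (cardsD1 l B) lB.
have deg_u : nbr_table e B (fun=> 1) u - 1 = #|nbrs e (B :\ l) u|.
  by rewrite deg_tableE // (card_nbrs_remove forest_e lB nbr_l) subn1.
have out_le : m rOut <= n by rewrite -out leq_addr.
have sum_l := nbr_table_single id lB nbr_l; rewrite map_cons in layout_m.
rewrite -(size_map val) in qs_le; have [lt_l lt_u] := (ltn_ord l, ltn_ord u).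
apply: wp_weaken (wp_remove layout_m sum_l lt_l lt_u nul out_le out_le qs_le) _ _ => //.
move=> m' [[rm tab qm] out' left' same]; split=> //; split; rewrite ?left' ?left ?out' //.
- split=> // [v lt_v|].
    by rewrite !(nbr_table_remove _ _ lB uB nul nbr_l) //; apply: tab.
  by move: qm; rewrite deg_u (fun_if (map val)) map_rcons.
- by rewrite addSnnS -B_card.
by rewrite B_card; lia.
Qed.

End Removal.

Section Rounds.
Variables (n W : nat) (e : rel 'I_n).
Hypotheses (W_large : 12 * n + 40 <= W) (forest_e : forest e).
Implicit Types (m : memory) (A B : {set 'I_n}) (qs ns : seq 'I_n).

Lemma uniq_ord_size qs : uniq qs -> size qs <= n.
Proof. by move=> /card_uniqP <-; rewrite -[leqRHS]card_ord max_card. Qed.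

Section Round.
Variables (A : {set 'I_n}) (qs : seq 'I_n).
Hypotheses (tree_A : subtree e A) (A_gt2 : 2 < #|A|).
Hypotheses (uniq_qs : uniq qs) (qsE : qs =i leaves e A).

Definition round_rest j : {set 'I_n} := A :\: [set x in take j qs].

Definition round_inv m0 j m : Prop := exists ns,
  [/\ frontier e A (round_rest j) ns, stores e m (round_rest j) (drop j qs ++ ns),
      m rOut = m0 rOut + j, m rK = m0 rK & m rLimit = queue_at n (m0 rOut + size qs) - 1].

Lemma round_rest_step j (x : 'I_n) : j < size qs ->
  round_rest j.+1 = round_rest j :\ nth x qs j.
Proof.
move=> lt_j; apply/setP => y; rewrite !inE (take_nth x lt_j) mem_rcons inE negb_or.
by rewrite andbA.
Qed.

Lemma round_rest_sub j : round_rest j \subset A.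
Proof. exact: subsetDl. Qed.

Lemma peel_round_rest j : peel e A \subset round_rest j.
Proof.
apply/subsetP => x; rewrite mem_peel => /andP[xA inner]; rewrite !inE xA andbT.
by apply: contra inner => /mem_take; rewrite qsE.
Qed.

Lemma round_rest_end : round_rest (size qs) = peel e A.
Proof. by apply/setP => x; rewrite !inE take_size qsE inE. Qed.

Lemma wp_round_step m0 j m : j < size qs -> round_inv m0 j m ->
  wp W prog_remove m 20 (round_inv m0 j.+1).
Proof.
move=> lt_j [ns [front stores_m out k limit]].
have [x0 _] : exists x0 : 'I_n, x0 \in qs.
  by case: qs lt_j => // x s; exists x; rewrite mem_head.
rewrite (drop_nth x0 lt_j) cat_cons in stores_m.
set l := nth x0 qs j in stores_m; have leaf_l : l \in leaves e A by rewrite -qsE mem_nth.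
have rest_l : l \in round_rest j.
  rewrite !inE (subsetP (leaves_subset e A)) // andbT.
  have := uniq_qs; rewrite -{1}(cat_take_drop j qs) (drop_nth x0 lt_j) cat_uniq.
  by case/and3P=> _ /hasPn/(_ _ (mem_head _ _)).
have [u uP nbr_l] := leaf_single_nbr forest_e tree_A A_gt2 (peel_round_rest j)
  (round_rest_sub j) leaf_l.
have nul : u != l by move: uP; rewrite mem_peel => /andP[_]; apply: contraNneq => ->.
have rest_u := subsetP (peel_round_rest j) u uP.
have size_queue : size (drop j.+1 qs ++ ns) <= 2 * n.
  have := uniq_ord_size uniq_qs; have := uniq_ord_size front.1.
  by rewrite size_cat size_drop; lia.
apply: wp_weaken (wp_remove_leaf W_large forest_e stores_m size_queue rest_l rest_u nul nbr_l)
  (leqnn _) _ => m' [stores_m' out' same].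
have := frontier_remove forest_e (peel_round_rest j) rest_l uP nbr_l front.
rewrite -round_rest_step //; set ns' := if _ then _ else _ => front'.
exists ns'; split=> //.
- by move: stores_m'; rewrite -round_rest_step // /ns'; case: ifP; rewrite ?rcons_cat.
- by rewrite out' out addnS.
- by rewrite same.
by rewrite same.
Qed.

Lemma wp_round m : stores e m A qs ->
  wp W prog_round m (22 * #|leaves e A| + 3) (fun m' => m' rK = m rK /\
    exists2 ns, stores e m' (peel e A) ns & frontier e A (peel e A) ns).
Proof.
move=> stores_m; have [[_ _ [head tail _]] _ _] := stores_m.
have size_qs : size qs = #|leaves e A|.
  by rewrite -(card_uniqP uniq_qs); apply: eq_card.
have -> : 22 * #|leaves e A| + 3 = 1 + ((20 + 2) * size qs + 2) by rewrite size_qs; lia.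
rewrite size_map in tail; rewrite /prog_round; assign.
apply: wp_weaken (wp_for (J := round_inv m) _ (@wp_round_step m) _) (leqnn _) _.
- move=> j m' le_j [ns [_ [[_ _ [head' _ _]] _ _] out _ limit]].
  by rewrite /= head' out limit; lia.
- have rest0 : round_rest 0 = A by rewrite /round_rest take0 set_nil setD0.
  exists [::]; rewrite rest0 cats0 drop0; split; read => //; last by lia.
    exact: frontier_start.
  by apply: eq_stores stores_m => a; rewrite !inE => a_in; read.
move=> m' [ns [front stores_m' _ k _]]; split=> //; exists ns.
  by rewrite -round_rest_end -(cat0s ns) -(drop_size qs).
by rewrite -round_rest_end.
Qed.

End Round.
Section AllRounds.
Variable k : nat.

Definition rounds_inv t m : Prop := exists A qs,
  [/\ 30 * #|A| + 5 * (2 < m rK) + 2 <= t, subtree e A,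
      stores e m A qs /\ (2 < #|A| -> uniq qs /\ qs =i leaves e A), 0 < m rK &
      forall v, cc_value e A (m rK) v -> cc_value e setT k (v + m rOut)].

Lemma wp_rounds_step t m : rounds_inv t m -> 2 < m rK -> exists t1 t2, t1 + t2 + 2 <= t /\
  wp W prog_shrink m t1 (rounds_inv t2).
Proof.
move=> [A [qs [le_t tree_A [stores_m leaf_qs] k_gt0 value]]] k_gt2.
have [layout_m out left] := stores_m; rewrite k_gt2 in le_t.
rewrite /prog_shrink; have [A_le2|A_gt2] := leqP #|A| 2.
  exists 3, (30 * #|A| + 2); split; first by lia.
  branch=> [_|]; last by lia.
  assign; exists A, qs; split; read => //; first by rewrite muln0 addn0.
    by split=> //; apply: eq_stores stores_m => a; rewrite !inE => a_in; read.
  by move=> v /(cc_value_card_le2 A_le2 (ltnW k_gt2))/value.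
have [uniq_qs qsE] := leaf_qs A_gt2.
have leaves_gt0 : 0 < #|leaves e A| by apply: subtree_has_leaf (ltnW A_gt2).
have card_A : #|peel e A| + #|leaves e A| = #|A| := card_peel e A.
exists (22 * #|leaves e A| + 3 + 1).+2, (30 * #|peel e A| + 7); split; first by lia.
branch=> [|_]; first by lia.
apply: wp_seq; apply: wp_weaken (wp_round tree_A A_gt2 uniq_qs qsE stores_m) (leqnn _) _.
move=> m1 [k1 [ns stores_m1 front]]; have [_ out1 _] := stores_m1.
have out_eq : m1 rOut = #|leaves e A| + m rOut.
  apply: (@addIn #|peel e A|); rewrite out1 addnAC [#|leaves e A| + _]addnC card_A.
  by rewrite addnC out.
assign; exists (peel e A), ns; split; read.
- by rewrite -addnA leq_add2l; case: (2 < _).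
- exact: subtree_peel.
- split; first by apply: eq_stores stores_m1 => a; rewrite !inE => a_in; read.
  exact: frontier_leaves front.
- by lia.
by move=> v /(cc_value_peel forest_e tree_A A_gt2 k_gt2)/value; rewrite -addnA.
Qed.

End AllRounds.

Lemma wp_rounds m qs : subtree e setT -> stores e m setT qs -> uniq qs ->
  qs =i leaves e setT -> 0 < m rK ->
  wp W prog_rounds m (30 * n + 7) (fun m' => exists A ns,
    [/\ subtree e A, stores e m' A ns, 0 < m' rK <= 2 &
        forall v, cc_value e A (m' rK) v -> cc_value e setT (m rK) (v + m' rOut)]).
Proof.
move=> tree_T stores_m uniq_qs qsE k_gt0; have [_ out _] := stores_m.
apply: (wp_while (I := rounds_inv (m rK))) => [t m' []|t m'|]; last 1 first.
- exists setT, qs; split=> //; first by rewrite cardsT card_ord; case: (2 < _); lia.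
  have -> : m rOut = 0 by move: out; rewrite cardsT card_ord; lia.
  by move=> v; rewrite addn0.
- move=> A [ns [le_t tree_A [stores_m' _] k'_gt0 value]] /= k'_le2.
  by split; [lia | exists A, ns; rewrite k'_gt0].
exact: wp_rounds_step.
Qed.

Lemma wp_answer m A ns : 0 < n -> subtree e A -> stores e m A ns -> 0 < m rK <= 2 ->
  wp W prog_answer m (16 * n + 11) (fun m' =>
    exists2 v, cc_value e A (m rK) v & m' rOut = v + m rOut).
Proof.
move=> n_gt0 tree_A [layout_m out _] k_range; rewrite /prog_answer.
apply: wp_call (wp_max n_gt0 W_large layout_m) _ _ => [|m1 [max1 same]]; first by lia.
rewrite max_deg_table in max1.
have [out1 k1] : m1 rOut = m rOut /\ m1 rK = m rK by split; apply: same.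
have max_le : maxdeg e A <= n.
  by apply/bigmax_leqP => x _; rewrite -[leqRHS]card_ord max_card.
have -> : 16 * n + 11 - (16 * n + 5) = 5 + 1 by lia.
apply: wp_seq; branch=> [k_le1|k_gt1]; first branch=> [max_gt1|max_le1].
- do 2 assign; exists (minn 1 (maxdeg e A)); last by read; lia.
  by rewrite (_ : m rK = 1); [apply: cc_value_one | lia].
- apply: wp_skip; assign; exists (minn 1 (maxdeg e A)); last by read; lia.
  by rewrite (_ : m rK = 1); [apply: cc_value_one | lia].
apply: wp_skip; assign; exists (maxdeg e A); last by read; lia.
by rewrite (_ : m rK = 2); [apply: cc_value_two | lia].
Qed.

End Rounds.

Section TreeInput.
Variables (n k : nat) (e : rel 'I_n) (es : seq ('I_n * 'I_n)).
Hypotheses (tree_e : is_tree e) (edges_es : edge_list e es).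

Let ps := [seq (val p.1, val p.2) | p <- es].

Lemma tree_order_gt0 : 0 < n.
Proof. by case: tree_e; rewrite card_ord. Qed.

Lemma tree_size_edges : size es = n.-1.
Proof. by rewrite (size_edge_list tree_e edges_es) card_ord. Qed.

Lemma tree_input_pair i : i < size es ->
  nth 0 (tree_input k es) (2 + 2 * i) = (nth (0, 0) ps i).1 /\
  nth 0 (tree_input k es) (3 + 2 * i) = (nth (0, 0) ps i).2.
Proof.
rewrite !addSn !add0n /= /ps; elim: es i => // p s IHs [|i] // lt_i.
by rewrite mulnS !addSn add0n; apply: IHs.
Qed.

Lemma size_tree_input : size (tree_input k es) = 2 * n.
Proof.
have -> : size (tree_input k es) = 2 + 2 * size es.
  by rewrite /tree_input /=; elim: es => //= p s ->; lia.
by rewrite tree_size_edges; have := tree_order_gt0; lia.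
Qed.

Lemma tree_input_edges : {in ps, forall p, [/\ p.1 < n, p.2 < n & p.1 != p.2]}.
Proof.
move=> _ /mapP[p /(edge_list_edge tree_e edges_es) ep ->] /=; split=> //.
exact: (forest_neq (tree_forest tree_e) ep).
Qed.

Lemma leaf_queueE A : [seq v <- iota 0 (2 * n) | nbr_table e A (fun=> 1) v == 1] =
  map val (enum (leaves e A)).
Proof.
rewrite mul2n -addnn iotaD filter_cat [X in _ ++ X](_ : _ = [::]) ?cats0; last first.
  apply/eqP; rewrite -[_ == _]negbK -has_filter; apply/hasPn => v.
  by rewrite mem_iota => /andP[le_v _]; rewrite nbr_table_large.
rewrite -val_enum_ord filter_map; congr map; rewrite enumT.
apply: eq_filter => x; rewrite /= nbr_tableE sum1_card [RHS]inE.
by case: (x \in A).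
Qed.

Lemma wp_input W : 12 * n + 40 <= W -> 2 * n * n + n <= W ->
  wp W prog_input (nth 0 (tree_input k es)) (46 * n + 16) (fun m =>
    stores e m setT (enum (leaves e setT)) /\ m rK = k).
Proof.
move=> W_large W_square; have n_gt0 := tree_order_gt0; rewrite /prog_input.
have size_ps : size ps = n.-1 by rewrite size_map tree_size_edges.
apply: wp_call (wp_relocate W_large n_gt0 _ _) _ _ => //.
- by move=> a le_a; rewrite nth_default // size_tree_input.
- by lia.
move=> m1 [target edges k1 zero].
apply: wp_call (wp_setup W_large target zero) _ _; first by lia.
move=> m2 [layout2 [k2 left2] [index limit] same2].
apply: wp_call (wp_edges W_large W_square _ tree_input_edges layout2 _ index _) _ _.
- by rewrite size_ps; lia.
- move=> i lt_i; rewrite !same2; [|lia|lia]; rewrite !edges; [|lia|lia].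
  by apply: tree_input_pair; rewrite size_map in lt_i.
- by rewrite limit size_ps; lia.
- by lia.
move=> m3 [layout3 same3].
have {}layout3 : layout n m3 (nbr_table e setT (fun=> 1)) (nbr_table e setT id) 0 [::].
  by apply: eq_layout_tables layout3; apply: incident_nbr_table.
apply: wp_weaken (wp_leaves n_gt0 W_large layout3) _ _; first by lia.
move=> m4 [layout4 out4 same4]; rewrite leaf_queueE in layout4.
split; last by rewrite same4 // same3 // k2 k1.
by split; rewrite ?out4 // ?cardsT ?card_ord // same4 // same3.
Qed.

Lemma wp_prog_cc W : 0 < k -> 12 * n + 40 <= W -> 2 * n * n + n <= W ->
  wp W prog_cc (nth 0 (tree_input k es)) (126 * n) (fun m => is_cc e k (m 0)).
Proof.
move=> k_gt0 W_large W_square; have n_gt0 := tree_order_gt0.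
have forest_e := tree_forest tree_e.
apply: wp_call (wp_input W_large W_square) _ _ => [|m1 [stores1 k1]]; first by lia.
rewrite -k1 in k_gt0 *.
apply: wp_call (wp_rounds W_large forest_e (tree_subtree tree_e) stores1 _ _ k_gt0) _ _.
- exact: enum_uniq.
- by move=> x; rewrite mem_enum.
- by lia.
move=> m2 [A [ns [tree_A stores2 k2_range value]]].
apply: wp_weaken (wp_answer W_large forest_e n_gt0 tree_A stores2 k2_range) _ _.
  by lia.
by move=> m3 [v /value ccv ->]; apply: cc_value_is_cc.
Qed.

Lemma bounded_tree_input W : n <= W -> k <= W -> bounded W (nth 0 (tree_input k es)).
Proof.
move=> n_le k_le a; case: (ltnP a (size (tree_input k es))) => [lt_a|]; last first.
  by move=> /(nth_default 0) ->.
have := mem_nth 0 lt_a; rewrite !inE => /or3P[/eqP-> //|/eqP-> //|].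
case/flattenP=> _ /mapP[p _ ->]; rewrite !inE => /orP[]/eqP->.
  exact: leq_trans (ltnW (ltn_ord p.1)) n_le.
exact: leq_trans (ltnW (ltn_ord p.2)) n_le.
Qed.

End TreeInput.

Lemma word_bounds n k : 0 < n -> 0 < k ->
  let W := (n + k + 1) ^ 5 in
  [/\ 12 * n + 40 <= W, 2 * n * n + n <= W, n <= W & k <= W].
Proof.
move=> n_gt0 k_gt0 W; set s := n + k + 1.
have W_ge : 27 * (s * s) <= W.
  rewrite /W (_ : 5 = 3 + 2) // expnD mulnn leq_mul2r (_ : 27 = 3 ^ 3) // leq_exp2r //.
  by apply/orP; right; rewrite /s; lia.
have : (n + 2) * (n + 2) <= s * s by apply: leq_mul; rewrite /s; lia.
have : s <= s * s by apply: leq_pmulr; rewrite /s; lia.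
rewrite {1}/s; move: W s W_ge => W s; split; nia.
Qed.

Theorem theorem5p2 :
  exists (P : program) (C c : nat),
  forall (n k : nat) (e : rel 'I_n) (es : seq ('I_n * 'I_n)),
    is_tree e -> 0 < k -> edge_list e es ->
    exists2 m, is_cc e k m
             & ram_computes P (tree_input k es) (C * n) ((n + k + 1) ^ c) m.
Proof.
exists (compile 0 prog_cc), 126, 5 => n k e es tree_e k_gt0 edges_es.
have [W_large W_square n_le k_le] := word_bounds (tree_order_gt0 tree_e) k_gt0.
apply: wp_ram_computes; first exact: bounded_tree_input.
exact: wp_prog_cc.
Qed.
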